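(* Let $W=(N,w,\tau)$ be a TPWN. (1) There exists a value $ET_W\in\mathbb{R}_{\ge 0}\cup\{\infty\}$ such that for every scheduler $S$ of the MDP of $W$, the expected time $ET^S_W$ of $W$ under $S$ is equal to $ET_W$. (2) $ET_W$ is finite if and only if $N$ is sound.
   Context: A workflow net is a tuple $N=(P,T,F,i,o)$ where $P,T$ are disjoint finite sets of places and transitions, $F\subseteq (P\times T)\cup(T\times P)$ is a set of arcs, $i,o\in P$, $i$ has no incoming arcs, $o$ has no outgoing arcs, and the graph $(P\cup T, F\cup\{(o,i)\})$ is strongly connected. For $x\in P\cup T$ let ${}^\bullet x=\{y:(y,x)\in F\}$ and $x^\bullet=\{y:(x,y)\in F\}$; for sets $X$, ${}^\bullet X=\bigcup_{x\in X}{}^\bullet x$ and $X^\bullet=\bigcup_{x\in X}x^\bullet$. A marking is $M:P\to\mathbb{N}$; $t$ is enabled at $M$ if $M(p)\ge 1$ for all $p\in{}^\bullet t$, and firing $t$ yields $M'$ obtained by removing one token from each place of ${}^\bullet t$ and adding one token to each place of $t^\bullet$ (written $M\xrightarrow{t}M'$); firing sequences and reachability are as usual. The initial marking $\mathbf{i}$ (final marking $\mathbf{o}$) has one token in $i$ (in $o$) and none elsewhere. $N$ is sound if $\mathbf{o}$ is reachable from every marking reachable from $\mathbf{i}$; $N$ is 1-safe if every reachable marking $M$ has $M(p)\le 1$ for all $p$; 1-safe markings are identified with sets of places. Transitions $t_1,t_2$ are independent if ${}^\bullet t_1\cap{}^\bullet t_2=\emptyset$, dependent otherwise. For a 1-safe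 marking $M$, two transitions are concurrent at $M$ if both are enabled at $M$ and independent, and in conflict at $M$ if both are enabled at $M$ and dependent. For $t$ enabled at $M$, $C(t,M)$ is the set of transitions in conflict with $t$ at $M$ (it contains $t$), and $\mathcal{C}(M)=\{C(t,M): t \text{ enabled at } M\}$ is the set of conflict sets of $M$. A 1-safe workflow net is confusion-free if for every reachable marking $M$, every $t$ enabled at $M$ and every $u$ concurrent with $t$ at $M$: $C(u,M)=C(u,M\setminus{}^\bullet t)=C(u,(M\setminus{}^\bullet t)\cup t^\bullet)$. A TPWN is $W=(N,w,\tau)$ with $N$ a 1-safe confusion-free workflow net, $w:T\to\mathbb{Q}_{>0}$ and $\tau:T\to\mathbb{N}$. Timing: let $\mathbb{N}_\bot=\{\bot\}\cup\mathbb{N}$ with $\bot\le x$ and $\bot+x=\bot$ for all $x$. For $\vec x\in\mathbb{N}_\bot^P$, $t\in T$: $upd(\vec x,t)_p=\max_{q\in{}^\bullet t}\vec x_q+\tau(t)$ if $p\in t^\bullet$; $=\bot$ if $p\in{}^\bullet t\setminus t^\bullet$; $=\vec x_p$ otherwise. Define $\mu:T^*\to\mathbb{N}_\bot^P$ by $\mu(\epsilon)_i=0$, $\mu(\epsilon)_p=\bot$ for $p\ne i$, $\mu(\sigma t)=upd(\mu(\sigma),t)$, and $\mathit{time}(\sigma)=\max_{p\in P}\mu(\sigma)_p$. MDP semantics: states are 1-safe markings $M$ and pairs $(M,t)$ with $t$ enabled at $M$; initial state $\mathbf{i}$. At a marking enabling no transition the only distribution is the Dirac distribution on $M$ itself.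 At a marking $M$ enabling some transition there is one distribution $\lambda_C$ per $C\in\mathcal{C}(M)$, with $\lambda_C((M,t))=w(t)/w(C)$ for $t\in C$ (where $w(C)=\sum_{t\in C}w(t)$) and $0$ elsewhere. At $(M,t)$ the only distribution gives probability 1 to the $M'$ with $M\xrightarrow{t}M'$. A scheduler $S$ maps every finite path from $\mathbf{i}$ to one of the distributions available at its last state; it induces the standard probability measure $\mathit{Prob}^S$ on the set $\mathit{Paths}^S$ of infinite paths from $\mathbf{i}$ consistent with $S$. For an infinite path $\pi$ and a reachable marking $M$, $\mathit{time}(M,\pi)=\infty$ if $\pi$ never visits $M$, and otherwise $\mathit{time}(M,\pi)=\mathit{time}(\Sigma(\pi'))$ where $\Sigma(\pi')$ is the transition sequence along the shortest prefix $\pi'$ of $\pi$ ending at $M$. The expected time under $S$ is $ET^S_W=\sum_{\pi\in\mathit{Paths}^S}\mathit{time}(\mathbf{o},\pi)\cdot\mathit{Prob}^S(\pi)$, i.e. the expectation of $\mathit{time}(\mathbf{o},\cdot)$ under $\mathit{Prob}^S$. *)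

(* Defs.v *)
From HB Require Import structures.
From mathcomp Require Import all_boot all_order all_algebra.
From mathcomp Require Import all_classical all_reals all_analysis.

Set Implicit Arguments.
Unset Strict Implicit.
Unset Printing Implicit Defensive.
Import Order.TTheory GRing.Theory Num.Theory.
Local Open Scope classical_set_scope.
Local Open Scope ring_scope.

(** [flow_graph] is the graph on [P + T] with edge set [F] (given by its parts in
    [P * T] and [T * P]) extended with the edge [(o, i)]. *)
Definition flow_graph (P T : finType) (Fpt : {set P * T}) (Ftp : {set T * P})
    (i o : P) : rel (P + T) := fun x y =>
  match x, y with
  | inl p, inr t => (p, t) \in Fpt
  | inr t, inl p => (t, p) \in Ftp
  | inl p, inl q => (p == o) && (q == i)
  | inr _, inr _ => false
  end.

Record wfnet := WFNet {
  place : finType;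
  trans : finType;
  arc_pt : {set place * trans};
  arc_tp : {set trans * place};
  source : place;
  sink : place;
  source_no_in : forall t, (t, source) \notin arc_tp;
  sink_no_out : forall t, (sink, t) \notin arc_pt;
  strongly_connected :
    forall x y, connect (flow_graph arc_pt arc_tp source sink) x y }.

Section TokenGame.
Variable N : wfnet.

Definition pre (t : trans N) : {set place N} := [set p | (p, t) \in arc_pt N]%SET.
Definition post (t : trans N) : {set place N} := [set p | (t, p) \in arc_tp N]%SET.

Definition marking := {ffun place N -> nat}.
Implicit Types M : marking.

Definition enabled M (t : trans N) : bool := [forall p in pre t, (1 <= M p)%N].

Definition fire M (t : trans N) : marking :=
  [ffun p => (M p - (p \in pre t) + (p \in post t))%N].

Fixpoint firing_sequence M (s : seq (trans N)) M' : bool :=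
  if s is t :: s' then enabled M t && firing_sequence (fire M t) s' M'
  else M == M'.

Definition reachable M M' : Prop := exists s, firing_sequence M s M'.

(** The identification of sets of places with 1-safe markings. *)
Definition mark (A : {set place N}) : marking := [ffun p => nat_of_bool (p \in A)].

Definition sound : Prop :=
  forall M, reachable (mark [set source N]%SET) M -> reachable M (mark [set sink N]%SET).

Definition one_safe : Prop :=
  forall M, reachable (mark [set source N]%SET) M -> forall p, (M p <= 1)%N.

End TokenGame.

Section Conflicts.
Variable N : wfnet.
Implicit Types (M : {set place N}) (t u : trans N).

(** Enabledness and firing for sets of places; they agree with [enabled] and [fire]
    through [mark], see [enabled_mark] and [fire_mark]. *)
Definition senabled M t : bool := pre t \subset M.
Definition sfire M t : {set place N} := (M :\: pre t) :|: post t.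

Lemma enabled_mark M t : enabled (mark M) t = senabled M t.
Proof.
by apply/forall_inP/fintype.subsetP => H p /H; rewrite ffunE; case: (p \in M).
Qed.

Lemma fire_mark M t : senabled M t -> (forall p, (fire (mark M) t p <= 1)%N) ->
  fire (mark M) t = mark (sfire M t).
Proof.
move=> /fintype.subsetP en sf; apply/ffunP => p; have := sf p; have := en p.
rewrite !ffunE finset.in_setU finset.in_setD.
by case: (p \in pre t) => [/(_ isT) ->|_]; case: (p \in post t); case: (p \in M).
Qed.

Definition independent t u : bool := [disjoint pre t & pre u].

Definition concurrent M t u : bool :=
  [&& senabled M t, senabled M u & independent t u].

Definition in_conflict M t u : bool :=
  [&& senabled M t, senabled M u & ~~ independent t u].

Definition conflict_set t M : {set trans N} := [set u | in_conflict M t u]%SET.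

Definition conflict_sets M : {set {set trans N}} :=
  [set conflict_set t M | t in senabled M]%SET.

Definition confusion_free : Prop :=
  forall M, reachable (mark [set source N]%SET) (mark M) ->
  forall t u, senabled M t -> concurrent M t u ->
    conflict_set u M = conflict_set u (M :\: pre t) /\
    conflict_set u (M :\: pre t) = conflict_set u ((M :\: pre t) :|: post t).

End Conflicts.

Record tpwn := TPWN {
  net :> wfnet;
  net_one_safe : one_safe net;
  net_confusion_free : confusion_free net;
  weight : trans net -> rat;
  weight_gt0 : forall t, 0 < weight t;
  delay : trans net -> nat }.

(** [option nat] is [nat] extended with [None] as bottom element. *)
Definition bmax (x y : option nat) : option nat :=
  match x, y with
  | Some m, Some n => Some (maxn m n)
  | None, _ => y
  | _, None => x
  end.

Definition badd (x : option nat) (n : nat) : option nat :=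
  omap (fun m => (m + n)%N) x.

Section Timing.
Variable W : tpwn.

Definition timestamps := {ffun place W -> option nat}.

Definition upd (x : timestamps) (t : trans W) : timestamps :=
  [ffun p => if p \in post t then badd (\big[bmax/None]_(q in pre t) x q) (delay t)
             else if p \in pre t then None
             else x p].

Definition mu0 : timestamps :=
  [ffun p => if p == source W then Some 0%N else None].

Definition mu (s : seq (trans W)) : timestamps := foldl upd mu0 s.

Definition time (s : seq (trans W)) : option nat := \big[bmax/None]_p mu s p.

End Timing.

Definition cylinder (E : finType) (h : seq E) : set (nat -> E) :=
  [set pi | mkseq pi (size h) = h].

(** The parameter [x0] only serves to make the type pointed. *)
Definition trajectory (E : finType) (x0 : E) : Type := nat -> E.
HB.instance Definition _ (E : finType) (x0 : E) :=
  Choice.on (trajectory x0).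
HB.instance Definition _ (E : finType) (x0 : E) :=
  isPointed.Build (trajectory x0) (fun=> x0).

Definition path_space (E : finType) (x0 : E) :=
  g_sigma_algebraType (range (@cylinder E) : set (set (trajectory x0))).

(** The states of [pi] at times [1], ..., [n]. *)
Definition prefix_of (E : Type) (pi : nat -> E) (n : nat) : seq E :=
  mkseq (fun k => pi k.+1) n.

(** Existence of the law of a process on [E] started at [x0] whose next state has
    law [K h] given the history [h]: subdivide [[0, 1[] into one interval [I h] of
    length [len h] per history, and push Lebesgue measure on [[0, 1[] forward. *)
Section HistoryProcess.
Variables (R : realType) (E : finType) (x0 : E) (K : seq E -> E -> R).
Hypothesis K_ge0 : forall h s, 0 <= K h s.
Hypothesis K_sum1 : forall h, \sum_s K h s = 1.

Let len h : R := \prod_(k < size h) K (take k h) (nth x0 h k).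

Let cum h j : R := \sum_(s : E | (enum_rank s < j)%N) K h s.

Let lo h : R :=
  \sum_(k < size h) len (take k h) * cum (take k h) (enum_rank (nth x0 h k)).

Let take_rc h (s : E) : take (size h) (rcons h s) = h.
Proof. by rewrite -cats1 take_size_cat. Qed.

Let len_rcons h s : len (rcons h s) = len h * K h s.
Proof.
rewrite /len size_rcons big_ord_recr /=.
rewrite nth_rcons ltnn eqxx take_rc.
congr (_ * _); apply: eq_bigr => k _.
by rewrite nth_rcons ltn_ord -cats1 takel_cat // ltnW.
Qed.

Let lo_rcons h s : lo (rcons h s) = lo h + len h * cum h (enum_rank s).
Proof.
rewrite /lo size_rcons big_ord_recr /=.
rewrite nth_rcons ltnn eqxx take_rc.
congr (_ + _); apply: eq_bigr => k _.
by rewrite nth_rcons ltn_ord -cats1 takel_cat // ltnW.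
Qed.

Let len_ge0 h : 0 <= len h. Proof. exact: prodr_ge0. Qed.

Let cum_mono h i j : (i <= j)%N -> cum h i <= cum h j.
Proof.
move=> ij; rewrite /cum [leRHS](bigID (fun s => (enum_rank s < i)%N)) /=.
rewrite -[leLHS]addr0 lerD ?sumr_ge0 //.
by rewrite le_eqVlt; apply/orP; left; apply/eqP/eq_bigl => s;
   case: ltnP => [/leq_trans->|]; rewrite ?andbF.
Qed.

Let cumS h s : cum h (enum_rank s).+1 = cum h (enum_rank s) + K h s.
Proof.
rewrite /cum (bigD1 s) //= addrC; congr (_ + _); apply: eq_bigl => s'.
by rewrite ltnS ltn_neqAle andbC (inj_eq val_inj) (inj_eq enum_rank_inj).
Qed.

Let I h : set R := [set u | lo h <= u < lo h + len h].

Let I_step h u : I h u -> exists s, I (rcons h s) u.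
Proof.
rewrite /I /= => /andP[lo_u u_hi].
have ex : exists j, u < lo h + len h * cum h j.
  exists #|E|; rewrite (_ : cum h _ = 1) ?mulr1 // -(K_sum1 h).
  by apply: eq_bigl => s; rewrite ltn_ord.
have [[|j] uj jmin] := ex_minnP ex.
  move: uj; rewrite /cum big_pred0 => [|s]; last by rewrite ltn0.
  by rewrite mulr0 addr0 ltNge lo_u.
have jE : (j < #|E|)%N.
  rewrite ltnNge; apply/negP => Ej; suff : (j < j)%N by rewrite ltnn.
  apply: jmin; rewrite (_ : cum h j = cum h j.+1) //.
  apply: eq_bigl => s; rewrite (leq_trans (ltn_ord _) Ej).
  by rewrite ltnS (ltnW (leq_trans (ltn_ord _) Ej)).
exists (enum_val (Ordinal jE)); rewrite lo_rcons len_rcons -addrA -mulrDr -cumS.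
rewrite enum_valK /= uj andbT leNgt; apply/negP => /jmin.
by rewrite ltnn.
Qed.

Let I_sub h s u : I (rcons h s) u -> I h u.
Proof.
rewrite /I /= lo_rcons len_rcons -addrA -mulrDr -cumS => /andP[a b].
apply/andP; split.
  by apply: le_trans a; rewrite lerDl mulr_ge0 // sumr_ge0.
apply: (lt_le_trans b); rewrite lerD2l ler_piMr // -(K_sum1 h).
rewrite [leRHS](bigID (fun s' => (enum_rank s' < (enum_rank s).+1)%N)) /=.
by rewrite lerDl sumr_ge0.
Qed.

Let I_inj h s s' u : I (rcons h s) u -> I (rcons h s') u -> s = s'.
Proof.
rewrite /I /= !lo_rcons !len_rcons -!addrA -!mulrDr -!cumS.
move=> /andP[a b] /andP[c d]; apply: enum_rank_inj; apply: val_inj => /=.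
case: (ltngtP (enum_rank s) (enum_rank s')) => // lt_ss'.
- suff : u < u by rewrite ltxx.
  apply: (lt_le_trans b); apply: le_trans c.
  by rewrite lerD2l ler_wpM2l // cum_mono.
- suff : u < u by rewrite ltxx.
  apply: (lt_le_trans d); apply: le_trans a.
  by rewrite lerD2l ler_wpM2l // cum_mono.
Qed.

Let I0 : I [::] = `[0, 1[%classic.
Proof.
apply/seteqP; split=> u; rewrite /I /= in_itv /= /lo /len /= !big_ord0 add0r //.
Qed.

Let hist (u : R) : nat -> seq E := fix hist n :=
  if n is m.+1 then
    rcons (hist m) (odflt x0 [pick s | `[< I (rcons (hist m) s) u >]])
  else [::].

Let size_hist u n : size (hist u n) = n.
Proof. by elim: n => //= n IH; rewrite size_rcons IH. Qed.

Let histP u n : `[0, 1[%classic u -> I (hist u n) u.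
Proof.
rewrite -I0 => u01; elim: n => //= n /I_step[s Is].
by case: pickP => [s' /asboolP //|/(_ s)]; move/asboolP.
Qed.

Let hist_uniq u h : `[0, 1[%classic u -> I h u -> hist u (size h) = h.
Proof.
move=> u01; elim/last_ind: h => //= h s IH Is.
have hh := IH (I_sub Is); have := histP (size h).+1 u01.
by rewrite size_rcons /= hh => /I_inj -/(_ _ Is) ->.
Qed.

Let clamp (u : R) : R := if `[< `[0, 1[%classic u >] then u else 0.

Let clamp01 u : `[0, 1[%classic (clamp u).
Proof.
rewrite /clamp; case: asboolP => // _.
by rewrite /= in_itv /= lexx ltr01.
Qed.

Let I01 h : I h `<=` `[0, 1[%classic.
Proof. by rewrite -I0; elim/last_ind: h => // h s IH u /I_sub /IH. Qed.

Let X (u : measurableTypeR R) : path_space x0 := fun n => last x0 (hist (clamp u) n).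

Let X_prefix u n : mkseq (X u) n.+1 = x0 :: hist (clamp u) n.
Proof.
elim: n => // n IH; rewrite /mkseq -[in iota _ _]addn1 iotaD map_cat.
by rewrite -/(mkseq _ _) IH /= add0n -cats1 /X /= last_rcons.
Qed.

Let X_cyl u h : cylinder (x0 :: h) (X u) <-> I h (clamp u).
Proof.
rewrite /cylinder /= X_prefix; split=> [[<-]|Ih].
  by apply: histP; exact: clamp01.
by rewrite hist_uniq //; exact: clamp01.
Qed.

Let mI h : measurable (I h : set (measurableTypeR R)).
Proof.
rewrite (_ : I h = `[lo h, lo h + len h[%classic) //.
Qed.

Let clamp_pre h : clamp @^-1` I h =
  I h `|` (if `[< I h 0 >] then ~` `[0, 1[%classic else set0).
Proof.
apply/seteqP; split=> u; rewrite /clamp /=.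
  case: asboolP => [u01 Iu|u01 Iu]; [by left|right].
  by rewrite asboolT.
case=> [Iu|]; first by rewrite asboolT //; exact: (I01 Iu).
by case: asboolP => // I0u nu; rewrite asboolF.
Qed.

Let mX : measurable_fun setT X.
Proof.
apply: (measurability (range (@cylinder E) : set (set (path_space x0)))) => //.
move=> _ [_ [h _ <-] <-]; rewrite setTI.
case: h => [|s h].
  rewrite (_ : X @^-1` _ = setT); first exact: measurableT.
  by apply/seteqP; split.
have [->|sx] := eqVneq s x0; last first.
  rewrite (_ : X @^-1` _ = set0) //.
  apply/seteqP; split=> // u; rewrite /cylinder /= => -[Xs _].
  by move: sx; rewrite -Xs /X /= eqxx.
rewrite (_ : X @^-1` _ = clamp @^-1` I h); last first.
  by apply/seteqP; split => u /X_cyl.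
rewrite clamp_pre; apply: measurableU; first exact: mI.
by case: ifP => // _; apply: measurableC; exact: measurable_itv.
Qed.

HB.instance Definition _ := isMeasurableFun.Build _ _ _ _ X mX.

Let mu01 : set (measurableTypeR R) -> \bar R :=
  mrestr lebesgue_measure (measurable_itv `[0, 1[%R).

HB.instance Definition _ := Measure.on mu01.

Let mu01T : mu01 setT = 1%E.
Proof.
by rewrite /mu01 /mrestr setTI lebesgue_measure_itv /= lte_fin ltr01 oppr0 adde0.
Qed.

HB.instance Definition _ := Measure_isProbability.Build _ _ _ mu01 mu01T.

Lemma history_process_exists :
  exists P : probability (path_space x0) R, forall h : seq E,
    P (cylinder (x0 :: h)) =
      (\prod_(k < size h) K (take k h) (nth x0 h k))%:E.
Proof.
exists (distribution mu01 X) => h.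
rewrite /distribution /= /pushforward /= /mu01 /mrestr.
rewrite (_ : _ `&` _ = `[lo h, lo h + len h[%classic); last first.
  apply/seteqP; split=> u.
    by move=> [/X_cyl + u01]; rewrite /clamp asboolT //= in_itv.
  rewrite /= in_itv /= => Iu; have u01 : `[0, 1[%classic u by exact: (I01 (h := h)).
  by split=> //; apply/X_cyl; rewrite /clamp asboolT.
rewrite lebesgue_measure_itv /= lte_fin ltrDl.
case: ltP => [_|l0]; first by rewrite -EFinD addrAC subrr add0r.
by rewrite -/(len h) (le_anti (introT andP (conj l0 (len_ge0 h)))).
Qed.

End HistoryProcess.

Section MDP.
Variable W : tpwn.

Definition state : finType :=
  ({set place W} + {x : {set place W} * trans W | senabled x.1 x.2})%type.

Definition init : state := inl [set source W]%SET.

Definition distr := {ffun state -> rat}.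

Definition dirac_at (s : state) : distr := [ffun s' => (s' == s)%:R].

Definition weight_of (C : {set trans W}) : rat := \sum_(t in C) weight t.

Definition lambda_prob (M : {set place W}) (C : {set trans W}) (s : state) : rat :=
  match s with
  | inl _ => 0
  | inr x => if ((val x).1 == M) && ((val x).2 \in C)
             then weight (val x).2 / weight_of C else 0
  end.

Definition lambda (M : {set place W}) (C : {set trans W}) : distr :=
  finfun (lambda_prob M C).

Definition distrs (s : state) : seq distr :=
  match s with
  | inl M => if [exists t, senabled M t]
             then [seq lambda M C | C <- enum (conflict_sets M)]
             else [:: dirac_at (inl M)]
  | inr x => [:: dirac_at (inl (sfire (val x).1 (val x).2))]
  end.

Definition step (s s' : state) : bool := has (fun d : distr => 0 < d s') (distrs s).

(** A finite path [init, s_1, ..., s_n] is represented by its tail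
    [[:: s_1; ...; s_n]]. *)
Definition finite_path (h : seq state) : bool := path step init h.

(** The values of [choose] outside finite paths are irrelevant. *)
Record scheduler := Scheduler {
  choose :> seq state -> distr;
  chooseP : forall h, finite_path h -> choose h \in distrs (last init h) }.

(** Product of the transition probabilities along [init, s_1, ..., s_n]. *)
Definition path_weight (S : scheduler) (h : seq state) : rat :=
  \prod_(k < size h) S (take k h) (nth init h k).

Definition paths (S : scheduler) : set (nat -> state) :=
  [set pi | pi 0%N = init /\ forall n, 0 < S (prefix_of pi n) (pi n.+1)].

Definition transitions (h : seq state) : seq (trans W) :=
  pmap (fun s : state => if s is inr x then Some (val x).2 else None) h.

Variable R : realType.

(** Bottom is embedded as [-oo]; it is never the time of a path reaching a
    nonempty marking. *)
Definition ereal_of (x : option nat) : \bar R :=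
  if x is Some n then n%:R%:E else -oo%E.

Definition time_to (M : {set place W}) (pi : nat -> state) : \bar R :=
  match pselect (exists n, pi n == inl M) with
  | left ex => ereal_of (time (transitions (mkseq pi (ex_minn ex).+1)))
  | right _ => +oo%E
  end.

Definition induced_by (S : scheduler) (P : probability (path_space init) R) : Prop :=
  forall h, P (cylinder (init :: h)) = (ratr (path_weight S h))%:E.

End MDP.

Section InducedMeasure.
Variable W : tpwn.
Implicit Types (s : state W) (h : seq (state W)) (S : scheduler W).

Lemma pre_neq0 (t : trans W) : pre t != finset.set0.
Proof.
have /connectP[p] := strongly_connected (inl (source W)) (inr t).
case/lastP: p => // p y; rewrite rcons_path last_rcons => /andP[_ +] ty.
rewrite -{}ty; case: (last _ p) => //= q qt.
by apply/set0Pn; exists q; rewrite inE.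
Qed.

Lemma distrs_neq0 s : exists d, d \in distrs s.
Proof.
case: s => [M|x] /=; last by eexists; rewrite inE.
case: existsP => [[t Mt]|_]; last by eexists; rewrite inE.
exists (lambda M (conflict_set t M)); apply: map_f; rewrite mem_enum.
exact: imset_f.
Qed.

Lemma scheduler_exists : inhabited (scheduler W).
Proof.
by apply: inhabits; apply: (@Scheduler W
  (fun h => xchoose (distrs_neq0 (last (init W) h)))) => h _; exact: xchooseP.
Qed.

Lemma distrs_ge0 s d s' : d \in distrs s -> 0 <= d s'.
Proof.
case: s => [M|x] /=; last by rewrite inE => /eqP->; rewrite ffunE ler0n.
case: ifP => _; last by rewrite inE => /eqP->; rewrite ffunE ler0n.
move=> /mapP[C _ ->]; rewrite ffunE; case: s' => //= x; case: ifP => // _.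
by rewrite divr_ge0 ?sumr_ge0 // => *; exact/ltW/weight_gt0.
Qed.

Let sum_dirac s : \sum_s' dirac_at s s' = 1 :> rat.
Proof.
rewrite (bigD1 s) //= ffunE eqxx big1 ?addr0 // => s' /negPf ss'.
by rewrite ffunE ss'.
Qed.

Lemma distrs_sum1 s d : d \in distrs s -> \sum_s' d s' = 1.
Proof.
case: s => [M|x] /=; last by rewrite inE => /eqP->.
case: ifP => _; last by rewrite inE => /eqP->.
move=> /mapP[C]; rewrite mem_enum => /imsetP[t Mt ->] ->.
have {}Mt : senabled M t := Mt; set D := conflict_set t M.
have D0 : weight_of D != 0.
  rewrite gt_eqF // /weight_of (bigD1 t) /=; last first.
    rewrite inE /in_conflict Mt /= /independent -setI_eq0 finset.setIid.
    exact: pre_neq0.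
  by rewrite ltr_wpDr ?weight_gt0 // sumr_ge0 // => *; exact/ltW/weight_gt0.
pose F (u : trans W) : rat := if u \in D then weight u / weight_of D else 0.
transitivity (\sum_(x : {x : {set place W} * trans W | senabled x.1 x.2}
    | (val x).1 == M) F (val x).2).
  rewrite (bigID (fun s : state W => if s is inr x then (val x).1 == M else false)).
  rewrite /= [X in _ + X]big1 ?addr0; last first.
    by move=> [M'|x] //=; rewrite ffunE //= => /negPf->.
  rewrite big_sumType /= big_pred0 ?add0r //.
  by apply: eq_bigr => x xM; rewrite ffunE /= xM.
transitivity (\sum_(u | senabled M u) F u).
  rewrite [RHS](reindex_omap
    (fun x : {x : {set place W} * trans W | senabled x.1 x.2} => (val x).2)
    (fun u => insub (M, u))) /=; last by move=> u Mu; rewrite insubT.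
  apply: eq_bigl => -[[M' u] /= M'u]; apply/eqP/andP => [MM'|[Mu]].
    by subst M'; split=> //; rewrite insubT; apply/eqP; congr Some; exact: val_inj.
  by rewrite insubT => /eqP[].
rewrite /F -big_mkcondr /= -mulr_suml.
rewrite (eq_bigl (fun u => u \in D)); first by rewrite divff.
by move=> u; rewrite inE /in_conflict Mt /= andbA andbb.
Qed.

Lemma path_weight_rcons S h s : path_weight S (rcons h s) = path_weight S h * S h s.
Proof.
rewrite /path_weight size_rcons big_ord_recr /= nth_rcons ltnn eqxx.
rewrite (_ : take (size h) (rcons h s) = h); last by rewrite -cats1 take_size_cat.
congr (_ * _); apply: eq_bigr => k _.
by rewrite nth_rcons ltn_ord -cats1 takel_cat // ltnW.
Qed.

Lemma path_weight_neq0 S h : path_weight S h != 0 -> finite_path h.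
Proof.
elim/last_ind: h => // h s IH; rewrite path_weight_rcons mulf_eq0 negb_or.
move=> /andP[/IH hp hs]; rewrite /finite_path rcons_path [path _ _ _]hp /=.
apply/hasP; exists (S h); first exact: chooseP.
by rewrite lt_neqAle eq_sym hs (distrs_ge0 _ (chooseP S hp)).
Qed.

Variable R : realType.

Lemma induced_exists S : exists P : probability (path_space (init W)) R, induced_by S P.
Proof.
pose K h : distr W := if finite_path h then S h else dirac_at (init W).
have K_ok h : K h \in distrs (last (init W) h) \/ K h = dirac_at (init W).
  by rewrite /K; case: ifP => [/(chooseP S)|_]; [left|right].
have [||P PE] := @history_process_exists R _ (init W) (fun h s => ratr (K h s)).
- move=> h s; rewrite ler0q; case: (K_ok h) => [/distrs_ge0 //|->].
  by rewrite ffunE ler0n.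
- move=> h; rewrite -rmorph_sum /= (_ : \sum_s K h s = 1) ?rmorph1 //.
  by case: (K_ok h) => [/distrs_sum1 //|->].
exists P => h; rewrite PE -rmorph_prod /=; congr (ratr _)%:E.
elim/last_ind: h => [|h s IH]; first by rewrite /path_weight !big_ord0.
rewrite path_weight_rcons size_rcons big_ord_recr /= nth_rcons ltnn eqxx.
rewrite (_ : take (size h) (rcons h s) = h); last by rewrite -cats1 take_size_cat.
rewrite (eq_bigr (fun k : 'I_(size h) => K (take k h) (nth (init W) h k))); last first.
  by move=> k _; rewrite nth_rcons ltn_ord -cats1 takel_cat // ltnW.
rewrite IH; have [->|/path_weight_neq0 hp] := eqVneq (path_weight S h) 0.
  by rewrite !mul0r.
by rewrite /K hp.
Qed.

Lemma induced_unique S (P Q : probability (path_space (init W)) R) :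
  induced_by S P -> induced_by S Q -> forall A, measurable A -> P A = Q A.
Proof.
move=> PS QS.
pose G : set (set (path_space (init W))) := set0 |` range (@cylinder (state W)).
have mC h : measurable (cylinder h : set (path_space (init W))).
  by apply: sub_sigma_algebra; exists h.
have null (P' : probability (path_space (init W)) R) : induced_by S P' ->
    forall s h, s != init W -> P' (cylinder (s :: h)) = 0%E.
  move=> P'S s h sN; apply/eqP; rewrite eq_le measure_ge0 andbT.
  have C1 : P' (cylinder [:: init W]) = 1%E.
    by rewrite P'S /path_weight big_ord0 rmorph1.
  have := probability_setC P' (mC [:: init W]); rewrite C1 subee // => <-.
  apply: le_measure; rewrite ?inE //; first by apply: measurableC; exact: mC.
  by move=> pi; rewrite /cylinder /= => -[pi0 _] [pi0']; move: sN; rewrite -pi0 pi0' eqxx.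
have nested h1 h2 : (size h1 <= size h2)%N ->
    cylinder h1 `&` cylinder h2 = set0 \/ cylinder h1 `&` cylinder h2 = cylinder h2
    :> set (nat -> state W).
  move=> le12; have [e|ne] := eqVneq (take (size h1) h2) h1.
    right; apply/seteqP; split=> [pi []//|pi pi2]; split=> //.
    rewrite /cylinder /= -[RHS]e -pi2 /mkseq -map_take take_iota.
    by rewrite (minn_idPl le12).
  left; apply/seteqP; split=> // pi [pi1 pi2]; move/eqP: ne; apply.
  by rewrite -{}pi2 -[RHS]pi1 /mkseq -map_take take_iota (minn_idPl le12).
apply: (measure_unique G (fun=> setT)) => //.
- apply/seteqP; split.
    by apply: sub_smallest2r; [exact: smallest_sigma_algebra|move=> A ?; right].
  apply: smallest_sub; first exact: smallest_sigma_algebra.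
  move=> A [->|GA]; last exact: sub_sigma_algebra.
  exact: (@measurable0 _ (path_space (init W))).
- move=> A B [->|[h1 _ <-]]; first by rewrite set0I; left.
  move=> [->|[h2 _ <-]]; first by rewrite setI0; left.
  have [le12|/ltnW le21] := leqP (size h1) (size h2).
    by case: (nested _ _ le12) => ->; [left|right; exists h2].
  by rewrite setIC; case: (nested _ _ le21) => ->; [left|right; exists h1].
- by move=> _; right; exists [::] => //; apply/seteqP; split.
- by apply/seteqP; split=> // x _; exists 0%N.
- move=> A [->|[[|s h] _ <-]]; first by rewrite !measure0.
    rewrite (_ : cylinder [::] = setT); last by apply/seteqP; split.
    exact: etrans (probability_setT P) (esym (probability_setT Q)).
  have [->|sN] := eqVneq s (init W); first exact: etrans (PS h) (esym (QS h)).
  exact: etrans (null P PS s h sN) (esym (null Q QS s h sN)).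
- move=> _; have PT : P setT = 1%E := probability_setT P.
  by suff : (P setT < +oo)%E by []; rewrite PT ltry.
Qed.

(** [Prob^S]; by [induced_unique] it is the only measure satisfying
    [sched_probP]. *)
Definition sched_prob S : probability (path_space (init W)) R :=
  projT1 (cid (induced_exists S)).

Lemma sched_probP S : induced_by S (sched_prob S).
Proof. exact: projT2 (cid (induced_exists S)). Qed.

Definition expected_time S : \bar R :=
  (\int[sched_prob S]_(pi in paths S) time_to R [set sink W]%SET pi)%E.

End InducedMeasure.

(* Main.v *)
Require Import Defs.
From mathcomp Require Import all_boot all_order all_algebra.
From mathcomp Require Import all_classical all_reals all_analysis.
From mathcomp Require Import measurable_realfun lra.

(* Fix one conflict set at each marking.  The mean of a function of the final
   timestamps over the runs that reach the sink in exactly [n] firings does not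
   depend on these choices: different conflict sets are concurrent, hence may be
   resolved in either order, with the same probabilities, marking and timestamps.
   Since the scheduler only chooses conflict sets, its expected time is the sum of
   these means, plus infinity if the probabilities of reaching the sink in [n]
   firings do not add up to [1].

   In a sound net the sink is reached from every reachable marking with positive
   probability, so the probability of firing at least [n] transitions decays
   geometrically and the sum converges.  Otherwise, resolving the conflict sets along
   a firing sequence to a marking from which the sink is unreachable shows that a
   positive amount of probability is lost. *)

Set Implicit Arguments.
Unset Strict Implicit.
Unset Printing Implicit Defensive.
Import Order.TTheory GRing.Theory Num.Theory.
Local Open Scope ring_scope.

(** * Concurrency and conflict at reachable markings *)

Section Reachability.
Variable W : tpwn.
Implicit Types (M : {set place W}) (t u : trans W) (s : seq (trans W)).

Definition sreachable M : Prop :=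
  reachable (mark [set source W]%SET) (mark M).

Lemma firing_sequence_cat (M1 M2 M3 : marking W) s1 s2 :
  firing_sequence M1 s1 M2 -> firing_sequence M2 s2 M3 ->
  firing_sequence M1 (s1 ++ s2) M3.
Proof.
by elim: s1 M1 => [M1 /eqP->|t s1 IH M1 /= /andP[-> /IH]].
Qed.

Lemma mark_inj : injective (@mark W).
Proof.
move=> A B /ffunP AB; apply/setP => p; have := AB p; rewrite !ffunE.
by case: (p \in A); case: (p \in B).
Qed.

Lemma sreachable_source : sreachable [set source W]%SET.
Proof. by exists [::] => /=. Qed.

Lemma fire_safe M t : sreachable M -> senabled M t ->
  forall p, (fire (mark M) t p <= 1)%N.
Proof.
move=> [s Ms] Mt; apply: (@net_one_safe W); exists (s ++ [:: t]).
by apply: firing_sequence_cat Ms _; rewrite /= enabled_mark Mt /=.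
Qed.

Lemma fire_markE M t : sreachable M -> senabled M t ->
  fire (mark M) t = mark (sfire M t).
Proof. by move=> rM Mt; apply: fire_mark => //; apply: fire_safe. Qed.

Lemma sreachable_fire M t : sreachable M -> senabled M t -> sreachable (sfire M t).
Proof.
move=> rM Mt; have [s Ms] := rM; exists (s ++ [:: t]).
by apply: firing_sequence_cat Ms _; rewrite /= enabled_mark Mt /= fire_markE.
Qed.

Lemma concurrent_sym M t u : concurrent M t u = concurrent M u t.
Proof. by rewrite /concurrent /independent disjoint_sym andbCA. Qed.

(** The place [p] already carries a token needed by [u], and [t] does not consume it, so firing [t]
    would put a second token there, against 1-safety. *)
Lemma concurrent_pre_post M t u p : sreachable M -> concurrent M t u ->
  p \in post t -> p \in pre u -> False.
Proof.
move=> rM /and3P[Mt Mu dis] pt pu; have := fire_safe rM Mt p.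
rewrite !ffunE pt (fintype.subsetP Mu _ pu).
by rewrite (disjointFl dis pu).
Qed.

Lemma concurrent_enabled M t u : concurrent M t u -> senabled (sfire M t) u.
Proof.
move=> /and3P[Mt Mu dis]; apply/fintype.subsetP => p pu.
rewrite /sfire finset.in_setU finset.in_setD (disjointFl dis pu).
by rewrite (fintype.subsetP Mu _ pu).
Qed.

(** Firing [t] and then [u], which is still enabled, would put two tokens on [p]: by
    [concurrent_pre_post], [u] does not consume the one produced by [t]. *)
Lemma concurrent_post M t u p : sreachable M -> concurrent M t u ->
  p \in post t -> p \in post u -> False.
Proof.
move=> rM c pt pu; have [Mt Mu dis] := and3P c.
have := fire_safe (sreachable_fire rM Mt) (concurrent_enabled c) p.
have /negbTE npu : p \notin pre u by apply/negP; exact: concurrent_pre_post c pt.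
by rewrite !ffunE pu npu /sfire finset.in_setU pt orbT.
Qed.

Lemma sfireC M t u : sreachable M -> concurrent M t u ->
  sfire (sfire M t) u = sfire (sfire M u) t.
Proof.
move=> rM c; apply/setP => p; rewrite /sfire !finset.in_setU !finset.in_setD.
rewrite !finset.in_setU !finset.in_setD.
have tu := @concurrent_pre_post _ _ _ p rM c.
have c' := c; rewrite concurrent_sym in c'.
have ut := @concurrent_pre_post _ _ _ p rM c'.
have [_ _ dis0] := and3P c; have dis := @disjointFr _ _ _ p dis0.
move: tu ut dis; case: (p \in post t); case: (p \in post u); case: (p \in pre t);
  case: (p \in pre u); case: (p \in M) => //= tu ut dis;
  by [case: (tu isT isT)|case: (ut isT isT)|have := dis isT].
Qed.

(** The inputs of [u] meet neither the inputs nor the outputs of [t], so [t] leaves the timestamps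
    read by [u] unchanged, and conversely; nor do the two write to a common output. *)
Lemma updC M (x : timestamps W) t u : sreachable M -> concurrent M t u ->
  upd (upd x t) u = upd (upd x u) t.
Proof.
have aux t' u' : sreachable M -> concurrent M t' u' ->
    \big[bmax/None]_(q in pre u') upd x t' q = \big[bmax/None]_(q in pre u') x q.
  move=> rM c; apply: eq_bigr => q qu; rewrite ffunE.
  have [_ _ dis] := and3P c; rewrite (disjointFl dis qu).
  by case: ifP => // qt; case: (concurrent_pre_post rM c qt qu).
move=> rM c; have c' := c; rewrite concurrent_sym in c'.
apply/ffunP => p; rewrite [LHS]ffunE [RHS]ffunE !aux // !ffunE.
have tu := @concurrent_pre_post _ _ _ p rM c.
have ut := @concurrent_pre_post _ _ _ p rM c'.
have tu' := @concurrent_post _ _ _ p rM c.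
move: tu ut tu'; case: (p \in post t); case: (p \in post u); case: (p \in pre t);
  case: (p \in pre u) => //= tu ut tu';
  by [case: (tu isT isT)|case: (ut isT isT)|case: (tu' isT isT)].
Qed.

Lemma mem_conflict_set M t : senabled M t -> t \in conflict_set t M.
Proof.
move=> Mt; rewrite inE /in_conflict Mt /= /independent -setI_eq0 finset.setIid.
exact: pre_neq0.
Qed.

Lemma conflict_set_enabled M t u : u \in conflict_set t M -> senabled M u.
Proof. by rewrite inE => /and3P[]. Qed.

Lemma conflict_set_sym M t u : (u \in conflict_set t M) = (t \in conflict_set u M).
Proof. by rewrite !inE /in_conflict /independent disjoint_sym andbCA. Qed.

Lemma notin_conflict_set M t u : senabled M t -> senabled M u ->
  (u \notin conflict_set t M) = concurrent M t u.
Proof. by move=> Mt Mu; rewrite inE /in_conflict /concurrent Mt Mu negbK. Qed.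

Lemma conflict_set_fire M t u : sreachable M -> concurrent M t u ->
  conflict_set u (sfire M t) = conflict_set u M.
Proof.
move=> rM c; have [Mt _ _] := and3P c.
by have [-> ->] := net_confusion_free rM Mt c.
Qed.

(* Confusion-freeness makes conflict at [M] transitive: if [v] conflicts with both
   [t] and [u], and these are concurrent, then firing [t] disables [v] and so
   changes the conflict set of [u]. *)
Lemma conflict_set_trans M t u v : sreachable M ->
  v \in conflict_set t M -> v \in conflict_set u M -> u \in conflict_set t M.
Proof.
move=> rM vt vu; have Mt : senabled M t by move: vt; rewrite inE => /and3P[].
have Mu : senabled M u by move: vu; rewrite inE => /and3P[].
apply/negPn/negP; rewrite notin_conflict_set // => c.
have [e _] := net_confusion_free rM Mt c; move: vu; rewrite e inE => /and3P[_ vM _].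
move: vt; rewrite inE => /and3P[_ _ /negP]; apply.
rewrite /independent disjoint_sym; apply/pred0P => p /=; apply/negbTE/negP.
move=> /andP[pv pt]; have := fintype.subsetP vM _ pv.
by rewrite finset.in_setD pt.
Qed.

(** Conflict is symmetric and, by [conflict_set_trans], transitive: the conflict sets are the
    classes of an equivalence on the enabled transitions. *)
Lemma conflict_set_eq M t u : sreachable M -> u \in conflict_set t M ->
  conflict_set u M = conflict_set t M.
Proof.
move=> rM ut; have tu := ut; rewrite conflict_set_sym in tu; apply/setP => v.
by apply/idP/idP; rewrite conflict_set_sym; exact: conflict_set_trans.
Qed.

Lemma enabled_neq_sink M t : senabled M t -> M != [set sink W]%SET.
Proof.
move=> Mt; apply/eqP => e; have /set0Pn[p pt] := pre_neq0 t.
have := fintype.subsetP Mt _ pt; rewrite e inE => /eqP ps.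
by move: pt; rewrite ps inE (negbTE (sink_no_out t)).
Qed.

End Reachability.

(** * Mean values over runs that resolve one conflict set at a time *)

Section OneStep.
Variables (W : tpwn) (R : realType).
Implicit Types (M : {set place W}) (t u : trans W) (x : timestamps W).
Implicit Types (f : {set place W} -> timestamps W -> R) (g : timestamps W -> R).

Definition prob (C : {set trans W}) u : R := ratr (weight u / weight_of C).

Definition fire_mean_at t f M x : R :=
  \sum_(u in conflict_set t M) prob (conflict_set t M) u * f (sfire M u) (upd x u).

(** The picked transition is arbitrary; [hit_meanS] shows that any other gives the same [hit_mean].
    The value 0 at a dead marking makes a run that has stopped contribute nothing to greater
    lengths. *)
Definition fire_mean f M x : R :=
  if [pick t | senabled M t] is Some t then fire_mean_at t f M x else 0.

Definition sink_value g M x : R := if M == [set sink W]%SET then g x else 0.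

(* Mean value of [g] on the runs that end in the sink after exactly [n] firings. *)
Definition hit_mean g n : {set place W} -> timestamps W -> R :=
  iter n fire_mean (sink_value g).

Lemma weight_of_ge0 (C : {set trans W}) : 0 <= weight_of C.
Proof. by apply: sumr_ge0 => t _; apply/ltW/weight_gt0. Qed.

Lemma prob_ge0 C u : 0 <= prob C u.
Proof. by rewrite ler0q divr_ge0 ?weight_of_ge0 // ltW ?weight_gt0. Qed.

Lemma weight_of_gt0 (C : {set trans W}) t : t \in C -> 0 < weight_of C.
Proof.
move=> tC; rewrite /weight_of (bigD1 t) //= ltr_wpDr ?weight_gt0 //.
by apply: sumr_ge0 => u _; apply/ltW/weight_gt0.
Qed.

Lemma prob_gt0 (C : {set trans W}) u : u \in C -> 0 < prob C u.
Proof. by move=> uC; rewrite ltr0q divr_gt0 ?weight_gt0 ?(weight_of_gt0 uC). Qed.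

Lemma prob_sum1 (C : {set trans W}) t : t \in C -> \sum_(u in C) prob C u = 1.
Proof.
move=> tC; rewrite -rmorph_sum /= -mulr_suml divff ?rmorph1 //.
by rewrite gt_eqF // (weight_of_gt0 tC).
Qed.

Variant fire_mean_spec f M x : R -> Prop :=
  | FireMeanDead of (forall t, ~~ senabled M t) : fire_mean_spec f M x 0
  | FireMeanAt t of senabled M t : fire_mean_spec f M x (fire_mean_at t f M x).

Lemma fire_meanP f M x : fire_mean_spec f M x (fire_mean f M x).
Proof.
rewrite /fire_mean; case: pickP => [t Mt|no]; first exact: FireMeanAt.
by apply: FireMeanDead => t; rewrite no.
Qed.

Lemma fire_mean_dead f M x : (forall t, ~~ senabled M t) -> fire_mean f M x = 0.
Proof.
by case: fire_meanP => // t Mt /(_ t); rewrite Mt.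
Qed.

Lemma fire_meanZ a f M x :
  fire_mean (fun M x => a * f M x) M x = a * fire_mean f M x.
Proof.
rewrite /fire_mean; case: pickP => [t _|_]; last by rewrite mulr0.
by rewrite /fire_mean_at mulr_sumr; apply: eq_bigr => u _; rewrite mulrCA.
Qed.

Lemma fire_meanD f1 f2 M x :
  fire_mean (fun M x => f1 M x + f2 M x) M x = fire_mean f1 M x + fire_mean f2 M x.
Proof.
rewrite /fire_mean; case: pickP => [t _|_]; last by rewrite addr0.
by rewrite /fire_mean_at -big_split /=; apply: eq_bigr => u _; rewrite mulrDr.
Qed.

Lemma le_fire_mean_at t f1 f2 M x :
  (forall u, senabled M u -> f1 (sfire M u) (upd x u) <= f2 (sfire M u) (upd x u)) ->
  fire_mean_at t f1 M x <= fire_mean_at t f2 M x.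
Proof.
move=> le12; apply: ler_sum => u /conflict_set_enabled Mu.
by rewrite ler_wpM2l ?prob_ge0 ?le12.
Qed.

Lemma le_fire_mean f1 f2 M x :
  (forall u, senabled M u -> f1 (sfire M u) (upd x u) <= f2 (sfire M u) (upd x u)) ->
  fire_mean f1 M x <= fire_mean f2 M x.
Proof.
by move=> le12; rewrite /fire_mean; case: pickP => // t _; exact: le_fire_mean_at.
Qed.

Lemma eq_fire_mean f1 f2 M x :
  (forall u, senabled M u -> f1 (sfire M u) (upd x u) = f2 (sfire M u) (upd x u)) ->
  fire_mean f1 M x = fire_mean f2 M x.
Proof.
by move=> e; apply/eqP; rewrite eq_le !le_fire_mean // => u /e ->.
Qed.

Lemma fire_mean_at_cst t a M x : senabled M t -> fire_mean_at t (fun _ _ => a) M x = a.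
Proof.
by move=> Mt; rewrite /fire_mean_at -mulr_suml (prob_sum1 (mem_conflict_set Mt)) mul1r.
Qed.

Lemma hit_mean_ge0 g n M x : (forall y, 0 <= g y) -> 0 <= hit_mean g n M x.
Proof.
move=> g0; elim: n M x => [|n IH] M x /=.
  by rewrite /sink_value; case: ifP.
case: fire_meanP => // t Mt; apply: sumr_ge0 => u _.
by rewrite mulr_ge0 ?prob_ge0 //; exact: IH.
Qed.

Lemma fire_mean_at_conflict t u f M x : sreachable M -> u \in conflict_set t M ->
  fire_mean_at u f M x = fire_mean_at t f M x.
Proof. by move=> rM ut; rewrite /fire_mean_at (conflict_set_eq rM ut). Qed.

(** A conflict between [v] and [w] would put [t] and [u] into the same conflict class. *)
Lemma concurrent_conflict M t u v w : sreachable M -> concurrent M t u ->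
  v \in conflict_set t M -> w \in conflict_set u M -> concurrent M v w.
Proof.
move=> rM c vt wu; have [Mt Mu _] := and3P c.
rewrite -notin_conflict_set ?(conflict_set_enabled vt) ?(conflict_set_enabled wu) //.
rewrite (conflict_set_eq rM vt); apply/negP => wt; move: c.
by rewrite -notin_conflict_set // (conflict_set_trans rM wt wu).
Qed.

(* The choice of the conflict set does not matter: two different conflict sets are
   concurrent, and by induction both values equal the mean over firing one
   transition of each. *)
Lemma hit_meanS g n t M x : sreachable M -> senabled M t ->
  hit_mean g n.+1 M x = fire_mean_at t (hit_mean g n) M x.
Proof.
elim: n t M x => [|n IH] t M x rM Mt.
all: rewrite /= {1}/fire_mean; case: pickP => [u Mu|/(_ t)]; last by rewrite Mt.
all: have [tu|] := boolP (t \in conflict_set u M).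
1,3: by rewrite (fire_mean_at_conflict _ _ rM tu).
all: rewrite notin_conflict_set // => c; have c' := c; rewrite concurrent_sym in c'.
  (* Base case: both sides vanish, since firing a transition of one conflict set leaves the other
     one enabled, so the marking reached is not the sink. *)
  rewrite /fire_mean_at !big1 // => v vt; rewrite /= /sink_value ifN ?mulr0 //.
    have cv := concurrent_conflict rM c' vt (mem_conflict_set Mu).
    exact: enabled_neq_sink (concurrent_enabled cv).
  have cv := concurrent_conflict rM c vt (mem_conflict_set Mt).
  exact: enabled_neq_sink (concurrent_enabled cv).
have expand t1 t2 : senabled M t1 -> senabled M t2 -> concurrent M t1 t2 ->
    fire_mean_at t1 (hit_mean g n.+1) M x =
    \sum_(v in conflict_set t1 M) \sum_(w in conflict_set t2 M)
      prob (conflict_set t1 M) v * (prob (conflict_set t2 M) w *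
       hit_mean g n (sfire (sfire M v) w) (upd (upd x v) w)).
  move=> M1 M2 c12; apply: eq_bigr => v v1.
  have c2 := concurrent_conflict rM c12 v1 (mem_conflict_set M2).
  rewrite (IH t2); last exact: concurrent_enabled c2.
    by rewrite /fire_mean_at mulr_sumr (conflict_set_fire rM c2).
  exact: sreachable_fire (conflict_set_enabled v1).
rewrite -/(iter n.+1 fire_mean (sink_value g)) -/(hit_mean g n.+1).
rewrite (expand u t) // (expand t u) // exchange_big /=.
apply: eq_bigr => v vt; apply: eq_bigr => w wu.
have cvw := concurrent_conflict rM c' vt wu.
by rewrite (sfireC rM cvw) (updC x rM cvw) mulrCA.
Qed.

Notation hit_prob := (hit_mean (fun=> 1)).

Lemma hit_mean0_enabled g t M x : senabled M t -> hit_mean g 0 M x = 0.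
Proof. by move=> Mt; rewrite /= /sink_value (negbTE (enabled_neq_sink Mt)). Qed.

Lemma sum_hit_probS n t M x : sreachable M -> senabled M t ->
  \sum_(k < n.+1) hit_prob k M x =
  fire_mean_at t (fun M x => \sum_(k < n) hit_prob k M x) M x.
Proof.
move=> rM Mt; rewrite big_ord_recl (hit_mean0_enabled _ _ Mt) add0r.
rewrite (eq_bigr (fun k : 'I_n => fire_mean_at t (hit_prob k) M x)); last first.
  by move=> k _; rewrite -hit_meanS.
by rewrite /fire_mean_at exchange_big /=; apply: eq_bigr => u _; rewrite mulr_sumr.
Qed.

(** Reaching the sink after different numbers of firings are disjoint events. Formally, the sum is
    averaged over the first firing; at a dead marking only the term [k = 0] survives. *)
Lemma sum_hit_prob_le1 n M x : sreachable M -> \sum_(k < n) hit_prob k M x <= 1.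
Proof.
elim: n M x => [|n IH] M x rM; first by rewrite big_ord0.
have [[t Mt]|no] := pselect (exists t, senabled M t).
  rewrite (sum_hit_probS _ _ rM Mt) -[leRHS](fire_mean_at_cst 1 x Mt).
  by apply: le_fire_mean_at => u Mu; apply: IH; exact: sreachable_fire.
rewrite big_ord_recl big1 ?addr0; last first.
  move=> k _ /=; apply: fire_mean_dead => t.
  by apply/negP => Mt; apply: no; exists t.
by rewrite /= /sink_value; case: ifP => //; rewrite ler01.
Qed.

(** By [hit_meanS] the conflict set to resolve may be that of the next transition of [s], so the run
    [s] itself contributes a positive product. *)
Lemma hit_prob_gt0 s M x : sreachable M ->
  firing_sequence (mark M) s (mark [set sink W]%SET) -> 0 < hit_prob (size s) M x.
Proof.
elim: s M x => [|t s IH] M x rM /=.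
  by move=> /eqP/mark_inj ->; rewrite /sink_value eqxx ltr01.
move=> /andP[]; rewrite enabled_mark => Mt; rewrite fire_markE // => sM.
change (0 < hit_prob (size s).+1 M x); rewrite (hit_meanS _ _ _ rM Mt).
have tC := mem_conflict_set Mt; rewrite /fire_mean_at (bigD1 t) //=.
apply: ltr_wpDr.
  by apply: sumr_ge0 => u _; rewrite mulr_ge0 ?prob_ge0 ?hit_mean_ge0.
by rewrite mulr_gt0 ?prob_gt0 //; apply: IH => //; exact: sreachable_fire.
Qed.

Lemma hit_prob_unreachable n M x : sreachable M ->
  ~ reachable (mark M) (mark [set sink W]%SET) -> hit_prob n M x = 0.
Proof.
elim: n M x => [|n IH] M x rM no.
  rewrite /= /sink_value; case: eqP => // e.
  by case: no; exists [::]; rewrite /= e.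
rewrite /=; case: fire_meanP => // t Mt; rewrite /fire_mean_at big1 // => u ut.
have Mu := conflict_set_enabled ut.
rewrite [X in _ * X]IH ?mulr0 //; first exact: sreachable_fire.
by move=> [s us]; apply: no; exists (u :: s); rewrite /= enabled_mark Mu fire_markE.
Qed.

(** The lost mass [p] is the product of the probabilities of the transitions of [s], each taken in
    its own conflict set; it is 1 at [M'] itself. *)
Lemma sum_hit_prob_le s M M' x : sreachable M -> firing_sequence (mark M) s (mark M') ->
  ~ reachable (mark M') (mark [set sink W]%SET) ->
  exists2 p, 0 < p & forall n, \sum_(k < n) hit_prob k M x <= 1 - p.
Proof.
move=> + + no; elim: s M x => [|t s IH] M x rM /=.
  move=> /eqP/mark_inj e; exists 1; first exact: ltr01.
  by move=> n; rewrite subrr big1 // => k _; rewrite hit_prob_unreachable // e.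
move=> /andP[]; rewrite enabled_mark => Mt; rewrite fire_markE // => tM'.
have [p p0 le_p] := IH _ (upd x t) (sreachable_fire rM Mt) tM'.
have tC := mem_conflict_set Mt.
have q0 := prob_gt0 tC; set q := prob _ _ in q0.
exists (q * p); first exact: mulr_gt0.
(* For the empty sum the claim is [q * p <= 1], where [p <= 1] comes from [le_p] at 0. *)
case=> [|n].
  rewrite big_ord0 subr_ge0; have := le_p 0%N; rewrite big_ord0 subr_ge0 => p1.
  have q1 : q <= 1.
    rewrite -(prob_sum1 tC) (bigD1 t) //= lerDl.
    by apply: sumr_ge0 => u _; exact: prob_ge0.
  by rewrite mulr_ile1 ?(ltW q0) ?(ltW p0).
(* Writing 1 as the mean of the constant 1 allows a comparison branch by branch: the branch of [t]
   loses [q * p], the others are at most 1. *)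
rewrite (sum_hit_probS _ _ rM Mt) -[X in _ <= X - _](fire_mean_at_cst 1 x Mt).
rewrite /fire_mean_at.
rewrite (bigD1 t) //= [X in _ <= X - _](bigD1 t) //= -/q addrAC -mulrBr.
apply: lerD; first by rewrite ler_wpM2l ?(ltW q0) ?le_p.
apply: ler_sum => u /andP[/conflict_set_enabled Mu _].
by rewrite ler_wpM2l ?prob_ge0 // sum_hit_prob_le1 //; exact: sreachable_fire.
Qed.

(** Bottom is read as 0 to get a nonnegative number; at the sink the time is never bottom, see
    [time_toE]. *)
Definition top (x : timestamps W) : nat := odflt 0 (\big[bmax/None]_p x p).

Definition max_delay : nat := \max_(t : trans W) delay t.

Lemma odflt_bmax (I : finType) (A : pred I) (F : I -> option nat) :
  odflt 0 (\big[bmax/None]_(p | A p) F p) = (\max_(p | A p) odflt 0 (F p))%N.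
Proof.
by apply: (big_morph (odflt 0)) => // -[m|] [n|] //=; rewrite ?maxn0 ?max0n.
Qed.

Lemma top_upd x t : (top (upd x t) <= top x + max_delay)%N.
Proof.
rewrite /top !odflt_bmax; apply/bigmax_leqP => p _; rewrite ffunE.
have xle q : (odflt 0 (x q) <= \max_q odflt 0 (x q))%N.
  exact: (leq_bigmax_cond (F := fun q => odflt 0 (x q))).
case: ifP => _; last first.
  by case: ifP => //= _; apply: leq_trans (xle p) _; exact: leq_addr.
apply: (@leq_trans (odflt 0 (\big[bmax/None]_(q in pre t) x q) + delay t)).
  by case: (\big[_/_]_(_ in _) _).
rewrite odflt_bmax leq_add //; first by apply/bigmax_leqP => q _.
exact: (leq_bigmax_cond (F := fun t : trans W => delay t)).
Qed.

(** Each of the [n] firings raises [top] by at most [max_delay]. *)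
Lemma hit_mean_top n M x : hit_mean (fun x => (top x)%:R) n M x <=
  (top x + max_delay * n)%N%:R * hit_prob n M x.
Proof.
elim: n M x => [|n IH] M x.
  rewrite muln0 addn0 /= /sink_value; case: ifP => _; rewrite ?mulr1 ?mulr0 //.
rewrite -fire_meanZ; apply: le_fire_mean => u _.
apply: le_trans (IH _ _) _; rewrite ler_wpM2r ?hit_mean_ge0 // ler_nat.
by rewrite mulnS addnA leq_add2r top_upd.
Qed.

(** The probability of firing at least [n] transitions, since [fire_mean] is 0 at dead markings. *)
Definition live_prob n : {set place W} -> timestamps W -> R :=
  iter n fire_mean (fun _ _ => 1).

Lemma live_prob_ge0 n M x : 0 <= live_prob n M x.
Proof.
elim: n M x => [|n IH] M x /=; first exact: ler01.
case: fire_meanP => // t Mt; apply: sumr_ge0 => u _.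
by rewrite mulr_ge0 ?prob_ge0 //; exact: IH.
Qed.

Lemma live_prob_le1 n M x : live_prob n M x <= 1.
Proof.
elim: n M x => [|n IH] M x //=; case: fire_meanP => [_|t Mt]; first exact: ler01.
rewrite -[leRHS](fire_mean_at_cst 1 x Mt); apply: le_fire_mean_at => u _; exact: IH.
Qed.

(** After the first [n] firings the marking is again reachable, and from there [N] more firings have
    probability at most [c]. *)
Lemma live_prob_contract N c : (forall M x, sreachable M -> live_prob N M x <= c) ->
  forall n M x, sreachable M -> live_prob (N + n) M x <= c * live_prob n M x.
Proof.
move=> le_c; elim=> [|n IH] M x rM; first by rewrite addn0 mulr1 le_c.
rewrite addnS /=.
rewrite -fire_meanZ; apply: le_fire_mean => u Mu.
by apply: IH; exact: sreachable_fire.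
Qed.

(** * Geometric decay of the number of firings in sound nets *)

Section Sound.
Hypothesis soundW : sound W.

(* By soundness the sink is the only reachable marking without successors. *)
Lemma live_probS n M x : sreachable M ->
  live_prob n M x = hit_prob n M x + live_prob n.+1 M x.
Proof.
elim: n M x => [|n IH] M x rM; last first.
  rewrite [hit_prob _ _ _]/(fire_mean (hit_prob n) M x).
  rewrite [live_prob n.+2 M x]/(fire_mean (live_prob n.+1) M x) -fire_meanD.
  by apply: eq_fire_mean => u Mu; apply: IH; exact: sreachable_fire.
rewrite /= /sink_value; case: eqP => [e|ne].
  rewrite fire_mean_dead ?addr0 // => t; apply/negP => Mt.
  by have := enabled_neq_sink Mt; rewrite e eqxx.
have [[|t s] /=] := soundW rM; first by move/eqP/mark_inj.
rewrite enabled_mark => /andP[Mt _]; rewrite add0r.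
by case: fire_meanP => [/(_ t)|t' Mt']; rewrite ?Mt ?fire_mean_at_cst.
Qed.

Lemma sum_hit_prob n M x : sreachable M ->
  \sum_(k < n) hit_prob k M x = 1 - live_prob n M x.
Proof.
move=> rM; elim: n => [|n IH]; first by rewrite big_ord0 /= subrr.
by have /= e := live_probS n x rM; rewrite big_ord_recr IH /=; lra.
Qed.

Lemma live_prob_decr m n M x : sreachable M -> (m <= n)%N ->
  live_prob n M x <= live_prob m M x.
Proof.
move=> rM /subnKC <-; elim: (n - m)%N => [|k IH]; first by rewrite addn0.
apply: le_trans IH; rewrite addnS (live_probS (m + k) x rM) lerDr.
exact: hit_mean_ge0.
Qed.

(** This makes the bounds of [live_prob_contracting] uniform in the timestamps. *)
Lemma hit_prob_timestamps n M x y : hit_prob n M x = hit_prob n M y.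
Proof.
elim: n M x y => [//|n IH] M x y /=; rewrite /fire_mean; case: pickP => // t _.
by apply: eq_bigr => u _; rewrite -!/(hit_prob n _ _) (IH _ _ (upd y u)).
Qed.

(** From each reachable marking a run to the sink of some length has positive probability, so longer
    runs have probability less than 1; there are only finitely many markings. *)
Lemma live_prob_contracting : exists N c,
  [/\ 0 <= c, c < 1 & forall M x, sreachable M -> live_prob N M x <= c].
Proof.
pose B (Nc : nat * R) M := Nc.2 < 1 /\
  forall x, sreachable M -> live_prob Nc.1 M x <= Nc.2.
have /choice[F BF] M : exists Nc, B Nc M.
  (* An unreachable marking gets the pair [(0, 0)], for which the bound is vacuous. *)
  have [rM|nrM] := pselect (sreachable M); last by exists (0%N, 0); split; rewrite ?ltr01.
  have [s Ms] := soundW rM; have p0 := hit_prob_gt0 (mu0 W) rM Ms.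
  exists ((size s).+1, 1 - hit_prob (size s) M (mu0 W)).
  split=> [|x _] /=; first by rewrite gtrBl.
  rewrite lerBrDl (hit_prob_timestamps _ _ _ x) -live_probS //; exact: live_prob_le1.
(* Raising a length to the maximum [N] is harmless, as [live_prob] decreases in it. The base 0 of
   the second maximum gives [0 <= c]. *)
pose N := (\max_M (F M).1)%N; pose c := \big[Order.max/0]_M (F M).2.
exists N, c; split.
- exact: bigmax_ge_id.
- by apply/bigmax_ltP; split=> [|M _]; [exact: ltr01|case: (BF M)].
- move=> M x rM; have [_ /(_ x rM) le_F] := BF M.
  apply: (@le_trans _ _ (F M).2); last exact: (le_bigmax_cond _ (fun M => (F M).2)).
  apply: le_trans le_F; apply: live_prob_decr => //.
  exact: (leq_bigmax_cond (F := fun M => (F M).1)).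
Qed.

(** With [A n] the partial sum, contraction gives [A n <= A (N + n) <= N + c * A n], hence
    [A n <= N / (1 - c)]. *)
Lemma sum_live_prob_bounded : exists B : R, forall n M x, sreachable M ->
  \sum_(k < n) live_prob k M x <= B.
Proof.
have [N [c [c0 c1 le_c]]] := live_prob_contracting.
exists (N%:R / (1 - c)) => n M x rM; rewrite ler_pdivlMr ?subr_gt0 // mulrBr mulr1.
rewrite lerBlDr; apply: (@le_trans _ _ (\sum_(k < N + n) live_prob k M x)).
  rewrite addnC big_split_ord /= lerDl.
  by apply: sumr_ge0 => k _; exact: live_prob_ge0.
rewrite big_split_ord /= lerD //.
  rewrite -[leRHS]mulr1 mulr_natl -[N in leRHS]card_ord -sumr_const.
  by apply: ler_sum => k _; exact: live_prob_le1.
rewrite mulrC mulr_sumr; apply: ler_sum => k _; exact: live_prob_contract.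
Qed.

(** Summation by parts: the mean number of firings is bounded by the sum of the tail
    probabilities. *)
Lemma sum_natr_hit_prob n M x : sreachable M ->
  \sum_(k < n) k%:R * hit_prob k M x <= \sum_(k < n) live_prob k M x.
Proof.
(* The boundary term [n%:R * live_prob n M x] makes the induction go through. *)
move=> rM; suff: \sum_(k < n) k%:R * hit_prob k M x + n%:R * live_prob n M x <=
    \sum_(k < n) live_prob k M x.
  by apply: le_trans; rewrite lerDl mulr_ge0 ?live_prob_ge0.
elim: n => [|n IH]; first by rewrite !big_ord0 mul0r addr0.
rewrite !big_ord_recr /= -addrA; apply: le_trans (lerD IH (lexx _)).
rewrite -addrA lerD2l [in leRHS](live_probS n x rM) mulrDr -!addrA lerD2l.
rewrite -natr1 mulrDl mul1r lerD2l lerDr; exact: hit_mean_ge0.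
Qed.

Lemma live_prob_small e : 0 < e -> exists n, live_prob n [set source W]%SET (mu0 W) < e.
Proof.
move=> e0; have [B leB] := sum_live_prob_bounded.
have rS := sreachable_source W; set M := [set _]%SET in rS *.
have [//|no] := pselect (exists n, live_prob n M (mu0 W) < e).
have ge_e n : e <= live_prob n M (mu0 W).
  by rewrite leNgt; apply/negP => lt_e; apply: no; exists n.
(* With this choice [n.+1] terms, each at least [e], add up to more than [B]. *)
pose n := Num.trunc (B / e); have := leB n.+1 M (mu0 W) rS.
rewrite leNgt => /negP[]; apply: (@lt_le_trans _ _ (e *+ n.+1)).
  have := truncnS_gt (B / e); rewrite ltr_pdivrMr // => /lt_le_trans; apply.
  by rewrite mulr_natl.
by rewrite -[n.+1 in leLHS]card_ord -sumr_const; apply: ler_sum => k _; exact: ge_e.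
Qed.

End Sound.
End OneStep.

(** * From the scheduler's choices to [hit_mean] *)

Section Histories.
Variables (W : tpwn) (R : realType) (S : scheduler W).
Implicit Types (M : {set place W}) (t u : trans W) (s : state W) (h : seq (state W)).
Implicit Types (g : timestamps W -> R) (F : seq (state W) -> R).

Let sinks : state W := inl [set sink W]%SET.

(** At [(M, t)] this is the marking after [t], in step with [transitions], which already lists
    [t]. *)
Definition current s : {set place W} :=
  match s with inl M => M | inr x => sfire (val x).1 (val x).2 end.

Definition firing_state M u : state W :=
  if insub (M, u) is Some x then inr x else inl M.

Lemma firing_stateP M u : senabled M u ->
  exists2 x : {x : {set place W} * trans W | senabled x.1 x.2},
    val x = (M, u) & firing_state M u = inr x.
Proof.
by move=> Mu; rewrite /firing_state insubT; eexists; last by [].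
Qed.

Lemma transitions_rcons h s : transitions (rcons h s) =
  if s is inr x then rcons (transitions h) (val x).2 else transitions h.
Proof.
rewrite /transitions -cats1 pmap_cat /=; case: s => [M|x] /=; first by rewrite cats0.
by rewrite cats1.
Qed.

Lemma bmax_neq_None (I : finType) (A : {set I}) (f : I -> option nat) i :
  i \in A -> f i != None -> \big[bmax/None]_(j in A) f j != None.
Proof.
move=> iA fi; have : i \in [seq j <- index_enum I | j \in A].
  by rewrite mem_filter iA mem_index_enum.
rewrite -big_filter; elim: [seq j <- _ | _] => //= j s IH; rewrite inE big_cons.
case/predU1P => [<-|/IH]; first by case: (f i) fi => // m _; case: (bigop _ _ _).
by case: (f j) => [m|//]; case: (bigop _ _ _).
Qed.

(** A new token is stamped with a maximum over a nonempty set of marked places, so marked places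
    never carry bottom. *)
Lemma finite_path_current h : finite_path h ->
  sreachable (current (last (init W) h)) /\
  forall p, p \in current (last (init W) h) -> mu (transitions h) p != None.
Proof.
elim/last_ind: h => [_|h s IH].
  split=> [|p]; first exact: sreachable_source.
  by rewrite /= inE => /eqP->; rewrite ffunE eqxx.
rewrite /finite_path rcons_path => /andP[/IH{IH} + /hasP[d]].
rewrite last_rcons transitions_rcons; case: (last _ h) => [M|x] /= [rM Mmu].
  case: ifP => _; last first.
    by rewrite inE => /eqP->; rewrite ffunE; case: eqP => [->|]; rewrite ?ltxx.
  move=> /mapP[C _ ->]; rewrite ffunE /lambda_prob; case: s => [?|[[M' t] M't]] /=.
    by rewrite ltxx.
  case: ifP => [/andP[/eqP e _] _|_]; last by rewrite ltxx.
  rewrite /= in M't; subst M'; split; first exact: sreachable_fire.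
  move=> p; rewrite finset.in_setU finset.in_setD /mu -cats1 foldl_cat /= ffunE.
  case: (p \in post t) => [_|/=]; last by rewrite orbF => /andP[/negbTE-> /Mmu].
  have /set0Pn[q qt] := pre_neq0 t.
  have : \big[bmax/None]_(q in pre t) (mu (transitions h)) q != None.
    by apply: (bmax_neq_None qt); apply: Mmu; exact: (fintype.subsetP M't).
  by rewrite /mu; case: (bigop _ _ _).
by rewrite inE => /eqP->; rewrite ffunE; case: eqP => [->|]; rewrite ?ltxx.
Qed.

(** The conditional expectation, given [h], of [F] at the next history. *)
Definition history_mean F h : R := \sum_s ratr (S h s) * F (rcons h s).

Lemma history_mean_dirac F h s : S h = dirac_at s -> history_mean F h = F (rcons h s).
Proof.
move=> e; rewrite /history_mean e (bigD1 s) //= ffunE eqxx rmorph1 mul1r.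
by rewrite big1 ?addr0 // => s' /negbTE ne; rewrite ffunE ne rmorph0 mul0r.
Qed.

Lemma history_mean_lambda F h M t : S h = lambda M (conflict_set t M) ->
  history_mean F h = \sum_(u in conflict_set t M)
    prob R (conflict_set t M) u * F (rcons h (firing_state M u)).
Proof.
move=> e; rewrite /history_mean e; set C := conflict_set t M.
rewrite big_sumType /= big1 ?add0r => [|M' _]; last by rewrite ffunE /= rmorph0 mul0r.
rewrite (bigID (fun x : {x : {set place W} * trans W | senabled x.1 x.2} =>
  ((val x).1 == M) && ((val x).2 \in C))) /= [X in _ + X]big1 ?addr0; last first.
  by move=> x /negbTE ne; rewrite ffunE /lambda_prob ne rmorph0 mul0r.
rewrite [RHS](reindex_omap
    (fun x : {x : {set place W} * trans W | senabled x.1 x.2} => (val x).2)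
    (fun u => insub (M, u))) /=; last first.
  by move=> u uC; rewrite insubT //; exact: conflict_set_enabled uC.
rewrite [LHS](eq_bigl (fun x : {x : {set place W} * trans W | senabled x.1 x.2} =>
   ((val x).2 \in C) && (insub (M, (val x).2) == Some x))); last first.
  move=> -[[M' u] M'u] /=; rewrite andbC; case uC: (u \in C) => //=.
  apply/eqP/eqP => [e'|].
    by subst M'; rewrite insubT; congr Some; exact: val_inj.
  by rewrite insubT ?(conflict_set_enabled uC) // => Mu [].
apply: eq_bigr => x /andP[xC /eqP xM]; rewrite /firing_state xM.
rewrite ffunE /lambda_prob xC andbT (_ : _ == M) //.
by move: xM; case: insubP => // y _ yM [<-]; rewrite yM.
Qed.

(** [belast (init W) h] lists the states before the last one, so only the prefix at which a path
    first enters the sink can get a nonzero value. *)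
Definition first_hit g h : R :=
  if (sinks \notin belast (init W) h) && (last (init W) h == sinks)
  then g (mu (transitions h)) else 0.

Lemma iter_history_mean_hit g n h : sinks \in belast (init W) h ->
  iter n history_mean (first_hit g) h = 0.
Proof.
elim: n h => [|n IH] h hs /=; first by rewrite /first_hit hs.
rewrite /history_mean big1 // => s _; rewrite IH ?mulr0 //.
by rewrite belast_rcons lastI mem_rcons inE hs orbT.
Qed.

Lemma iter_history_mean_dead g n h M : finite_path h -> last (init W) h = inl M ->
  (forall t, ~~ senabled M t) -> M != [set sink W]%SET ->
  iter n history_mean (first_hit g) h = 0.
Proof.
move=> + + no Mo; elim: n h => [|n IH] h fh hM /=.
  rewrite /first_hit hM [_ == sinks](_ : _ = false) ?andbF //.
  by apply/negbTE; apply: contra Mo => /eqP[->].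
have := Defs.chooseP S fh; rewrite hM /=; case: existsP => [[t Mt]|_].
  by move: (no t); rewrite Mt.
rewrite inE => /eqP e; rewrite (history_mean_dirac _ e); apply: IH.
  rewrite /finite_path rcons_path [path _ _ _]fh hM /= /step /=.
  case: existsP => [[t Mt]|_]; first by move: (no t); rewrite Mt.
  by rewrite /= ffunE eqxx ltr01.
by rewrite last_rcons.
Qed.

Lemma finite_path_rcons h s : finite_path h -> 0 < S h s -> finite_path (rcons h s).
Proof.
move=> fh hs; rewrite /finite_path rcons_path [path _ _ _]fh /=.
by apply/hasP; exists (S h) => //; exact: Defs.chooseP.
Qed.

(** Two MDP steps, the drawing of a transition and its firing, make one firing of the net. The
    scheduler's conflict set disappears from the result by [hit_meanS]. *)
Lemma iter_history_mean g n h M : finite_path h -> last (init W) h = inl M ->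
  sinks \notin belast (init W) h ->
  iter n history_mean (first_hit g) h =
  if odd n then 0 else hit_mean g n./2 M (mu (transitions h)).
Proof.
(* Strong induction, since [n] decreases by two per firing. *)
have [m] := ubnP n; elim: m n h M => // m IH n h M nm fh hM hs.
have [rM _] := finite_path_current fh; rewrite hM /= in rM.
(* At the sink both sides are 0 for [n > 0]: later visits are not first ones, and the sink marking
   is dead. *)
have [Mo|Mo] := eqVneq M [set sink W]%SET.
  case: n nm => [|n] _; first by rewrite /= /first_hit hs hM Mo eqxx /sink_value eqxx.
  rewrite iterS {1}/history_mean big1 => [|s _]; last first.
    rewrite iter_history_mean_hit ?mulr0 // belast_rcons lastI mem_rcons.
    by rewrite hM Mo inE eqxx.
  case: n => [//|n] /=; rewrite negbK; case: ifP => // _; rewrite fire_mean_dead // => t.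
  by apply/negP => /enabled_neq_sink; rewrite Mo eqxx.
have [[t0 Mt0]|no] := pselect (exists t, senabled M t); last first.
  have {}no t : ~~ senabled M t by apply/negP => Mt; apply: no; exists t.
  rewrite (iter_history_mean_dead _ _ fh hM) //; case: ifP => // _.
  by case: n./2 => [|k] /=; rewrite ?fire_mean_dead // /sink_value (negbTE Mo).
have hit0 : first_hit g h = 0.
  rewrite /first_hit hM [_ == sinks](_ : _ = false) ?andbF //.
  by apply/negbTE; apply: contra Mo => /eqP[->].
have := Defs.chooseP S fh; rewrite hM /=; case: existsP => [_|[]]; last by exists t0.
move=> /mapP[C]; rewrite mem_enum => /imsetP[t Mt ->] e; have {}Mt : senabled M t := Mt.
have hsM u : sinks \notin belast (init W) (rcons h (firing_state M u)).
  rewrite belast_rcons lastI mem_rcons inE negb_or hs andbT hM.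
  by apply: contra Mo => /eqP[->].
have fhu u : u \in conflict_set t M -> finite_path (rcons h (firing_state M u)).
  move=> ut; apply: finite_path_rcons => //; rewrite e ffunE.
  have Mu := conflict_set_enabled ut; have [x xE ->] := firing_stateP Mu.
  by rewrite /= xE /= ut eqxx divr_gt0 ?weight_gt0 ?(weight_of_gt0 ut).
case: n nm => [|[|n]] nm.
- by rewrite /= hit0 /sink_value (negbTE Mo).
- rewrite /= (history_mean_lambda _ e) big1 // => u ut.
  have [x xE sE] := firing_stateP (conflict_set_enabled ut).
  by rewrite /first_hit last_rcons sE andbF mulr0.
rewrite iterS (history_mean_lambda _ e) (_ : n.+2./2 = n./2.+1) //.
rewrite (_ : odd n.+2 = odd n) /= ?negbK // -/(hit_mean g n./2.+1 M _).
transitivity (\sum_(u in conflict_set t M) prob R (conflict_set t M) u *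
    if odd n then 0 else hit_mean g n./2 (sfire M u) (upd (mu (transitions h)) u)).
  apply: eq_bigr => u ut; congr (_ * _); have Mu := conflict_set_enabled ut.
  have [x xE sE] := firing_stateP Mu; have fu := fhu u ut.
  have eu : S (rcons h (firing_state M u)) = dirac_at (inl (sfire M u)).
    by have := Defs.chooseP S fu; rewrite last_rcons sE /= xE inE => /eqP.
  rewrite -iterS iterS (history_mean_dirac _ eu) (IH _ _ (sfire M u)) //.
  + by rewrite !transitions_rcons sE /= xE /mu -cats1 foldl_cat.
  + exact: ltnW.
  + by apply: finite_path_rcons fu _; rewrite eu ffunE eqxx ltr01.
  + by rewrite last_rcons.
  + rewrite belast_rcons lastI mem_rcons inE negb_or hsM andbT last_rcons sE.
    by [].
case: ifP => _; first by rewrite big1 // => u _; rewrite mulr0.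
exact: esym (hit_meanS _ _ _ rM Mt).
Qed.

End Histories.

Local Open Scope classical_set_scope.

(** * Finite enumeration of the histories of a given length *)

Fixpoint words (E : finType) n : seq (seq E) :=
  if n is m.+1 then [seq rcons h s | h <- words E m, s <- enum E] else [:: [::]].

Lemma mem_words (E : finType) n (h : seq E) : (h \in words E n) = (size h == n).
Proof.
elim: n h => [|n IH] h; first by rewrite inE size_eq0.
case/lastP: h => [|h s]; rewrite /= ?size_rcons ?eqSS -?IH.
  by apply/negbTE/negP => /allpairsP[[[|? ?] ?] [_ _]].
apply/allpairsP/idP => [[[h' s'] /= [h'n _ /rcons_inj[-> _]]] //|hn].
by exists (h, s); rewrite mem_enum.
Qed.

Lemma words_uniq (E : finType) n : uniq (words E n).
Proof.
elim: n => //= n IH; apply: allpairs_uniq => //; first exact: enum_uniq.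
by move=> [h1 s1] [h2 s2] _ _ /= /rcons_inj[-> ->].
Qed.

Lemma big_words_recr (R : nmodType) (E : finType) n (F : seq E -> R) :
  \sum_(h <- words E n.+1) F h = \sum_(h <- words E n) \sum_s F (rcons h s).
Proof.
by rewrite /= big_allpairs_dep; apply: eq_bigr => h _; rewrite big_enum.
Qed.

Lemma mkseq_prefix_of (E : Type) (pi : nat -> E) n :
  mkseq pi n.+1 = pi 0%N :: prefix_of pi n.
Proof. by rewrite /mkseq /= -[1%N]addn0 iotaDl -map_comp. Qed.

(** * Measurability and integrals on the path space *)

Section PathMeasure.
Variables (W : tpwn) (R : realType) (S : scheduler W).
Implicit Types (F : seq (state W) -> R) (pi : path_space (init W)).

Notation P := (sched_prob R S).
Let D : set (path_space (init W)) := paths S.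

Lemma measurable_cylinder h : measurable (cylinder h : set (path_space (init W))).
Proof. by apply: sub_sigma_algebra; exists h. Qed.

Lemma measurable_prefix (B : pred (seq (state W))) n :
  measurable [set pi : path_space (init W) | B (mkseq pi n)].
Proof.
rewrite (_ : mkset _ = \bigcup_(h in [set` [seq h <- words (state W) n | B h]])
    (cylinder h : set (path_space (init W)))); last first.
  apply/seteqP; split=> [pi /= Bpi|pi [h /=]].
    exists (mkseq pi n); last by rewrite /cylinder /= size_mkseq.
    by rewrite /= mem_filter Bpi mem_words size_mkseq eqxx.
  by rewrite mem_filter mem_words => /andP[Bh /eqP <-]; rewrite /cylinder /= => ->.
apply: fin_bigcup_measurable; first exact: finite_seq.
by move=> h _; exact: measurable_cylinder.
Qed.

Lemma take_prefix_of n pi : take n (prefix_of pi n.+1) = prefix_of pi n.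
Proof. by rewrite /prefix_of /mkseq -map_take take_iota (minn_idPl (leqnSn n)). Qed.

Lemma prefix_ofS n pi : prefix_of pi n.+1 = rcons (prefix_of pi n) (pi n.+1).
Proof. by rewrite /prefix_of /mkseq -addn1 iotaD map_cat /= add0n cats1 addn1. Qed.

Lemma measurable_paths : measurable D.
Proof.
(* [behead] drops the initial state: the choice after [n] steps and its outcome [pi n.+1] are read
   off the first [n.+2] states. *)
pose B n (h : seq (state W)) := 0 < S (take n (behead h)) (nth (init W) (behead h) n).
rewrite (_ : D = cylinder [:: init W] `&`
    \bigcap_n [set pi : path_space (init W) | B n (mkseq pi n.+2)]).
  apply: measurableI; first exact: measurable_cylinder.
  by apply: bigcap_measurable => // n _; exact: measurable_prefix.
have BE n pi : B n (mkseq pi n.+2) = (0 < S (prefix_of pi n) (pi n.+1)).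
  by rewrite /B mkseq_prefix_of /= take_prefix_of nth_mkseq.
apply/seteqP; split=> pi /=.
  move=> [pi0 pos]; split; first by rewrite /cylinder /= /mkseq /= pi0.
  by move=> n _ /=; rewrite BE.
move=> [pi0 pos]; split; first by case: pi0.
by move=> n; have /= := pos n I; rewrite BE.
Qed.

Lemma path_weight_prefix pi : pi 0%N = init W -> ~ paths S pi ->
  exists n, path_weight S (prefix_of pi n) = 0.
Proof.
move=> pi0 /not_andP[//|/existsNP[k /negP]]; rewrite -leNgt => le0.
(* A nonzero weight makes the prefix a finite path, along which the scheduler's values are known to
   be nonnegative. *)
have [w0|w0] := eqVneq (path_weight S (prefix_of pi k)) 0; first by exists k.
exists k.+1; rewrite prefix_ofS path_weight_rcons.
have fp := path_weight_neq0 w0; have ge0 := distrs_ge0 (pi k.+1) (Defs.chooseP S fp).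
by rewrite (_ : S _ _ = 0) ?mulr0 //; apply/eqP; rewrite eq_le le0 ge0.
Qed.

(** A trajectory outside [D] starts elsewhere or has a prefix of weight 0; there are countably many
    such prefixes, here enumerated by [unpickle], and their cylinders are null. *)
Lemma paths_full : P (~` D) = 0%E.
Proof.
apply: measure_negligible; first by apply: measurableC; exact: measurable_paths.
pose F k : set (path_space (init W)) :=
  if @unpickle (seq (state W)) k is Some h
  then if path_weight S h == 0 then cylinder (init W :: h) else set0 else set0.
pose C0 : set (path_space (init W)) := cylinder [:: init W].
have mC0 : measurable C0 := measurable_cylinder _.
apply: (@negligibleS _ _ _ _ (~` C0 `|` \bigcup_k F k)).
  move=> pi nD; have [pi0|ne] := eqVneq (pi 0%N) (init W); last first.
    by left; rewrite /C0 /cylinder /= /mkseq /= => -[e]; rewrite e eqxx in ne.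
  right; have [n w0] := path_weight_prefix pi0 nD.
  exists (pickle (prefix_of pi n)) => //; rewrite /F pickleK w0 eqxx /cylinder /=.
  by rewrite size_mkseq mkseq_prefix_of pi0.
apply: negligibleU.
  apply/negligibleP; first exact: measurableC.
  apply: etrans (probability_setC P mC0) _.
  by rewrite sched_probP /path_weight big_ord0 rmorph1 subee.
apply: negligible_bigcup => k; rewrite /F; case: unpickle => [h|]; last exact: negligible_set0.
case: eqP => [w0|_]; last exact: negligible_set0.
apply/negligibleP; first exact: measurable_cylinder.
by apply: etrans (sched_probP R S h) _; rewrite w0 rmorph0.
Qed.

Lemma sched_prob_paths A : measurable A -> P (A `&` D) = P A.
Proof.
move=> mA; rewrite [RHS](measureDI _ mA measurable_paths).
rewrite [X in (X + _)%E](_ : _ = 0%E) ?add0e //.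
apply: (@subset_measure0 _ _ _ _ _ (~` D)); last exact: paths_full.
- by apply: measurableD => //; exact: measurable_paths.
- by apply: measurableC; exact: measurable_paths.
- by move=> pi [].
Qed.

Lemma prefix_indic F n pi : D pi -> (F (prefix_of pi n))%:E =
  (\sum_(h <- words (state W) n) (F h)%:E * (\1_(cylinder (init W :: h)) pi)%:E)%E.
Proof.
move=> [pi0 _]; rewrite (bigD1_seq (prefix_of pi n)) ?words_uniq //=; last first.
  by rewrite mem_words size_mkseq.
have cylE h : (pi \in (cylinder (init W :: h) : set (path_space (init W)))) =
    (prefix_of pi (size h) == h).
  rewrite /cylinder; apply/idP/eqP => [|e]; rewrite inE /= mkseq_prefix_of pi0.
    by case.
  by rewrite e.
rewrite indicE cylE size_mkseq eqxx mule1 big_seq_cond big1 ?adde0 // => h.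
rewrite mem_words indicE cylE => /andP[/eqP -> ne].
by rewrite eq_sym (negbTE ne) mule0.
Qed.

Lemma measurable_fun_prefix F n :
  measurable_fun D (fun pi => (F (prefix_of pi n))%:E).
Proof.
apply: (eq_measurable_fun (fun pi => (\sum_(h <- words (state W) n)
  (F h)%:E * (\1_(cylinder (init W :: h)) pi)%:E)%E)).
  by move=> pi; rewrite inE => Dpi; rewrite -prefix_indic.
apply: emeasurable_sum => h; apply: emeasurable_funM; first exact: measurable_cst.
by apply/measurable_EFinP/measurable_indic; exact: measurable_cylinder.
Qed.

(** The integrand is a simple function, constant on cylinders; peeling the last factor off each
    [path_weight] turns the weighted sum into iterated conditional expectations. *)
Lemma integral_prefix F n : (forall h, 0 <= F h) ->
  (\int[P]_(pi in D) (F (prefix_of pi n))%:E =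
   (iter n (history_mean S) F [::])%:E)%E.
Proof.
move=> F0; have mI h : measurable_fun D (fun pi : path_space (init W) =>
    ((\1_(cylinder (init W :: h)) pi)%:E : \bar R)).
  by apply/measurable_EFinP/measurable_indic; exact: measurable_cylinder.
transitivity (\int[P]_(pi in D) (\sum_(h <- words (state W) n)
    (F h)%:E * (\1_(cylinder (init W :: h)) pi)%:E))%E.
  by apply: eq_integral => pi; rewrite inE; exact: prefix_indic.
rewrite ge0_integral_sum; last 3 first.
- exact: measurable_paths.
- by move=> h; apply: emeasurable_funM => //; exact: measurable_cst.
- by move=> h pi _; rewrite mule_ge0 ?lee_fin.
transitivity (\sum_(h <- words (state W) n) (ratr (path_weight S h) * F h)%:E)%E.
  apply: eq_bigr => h _; rewrite ge0_integralZl_EFin //; last exact: measurable_paths.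
  have mC := measurable_cylinder (init W :: h).
  rewrite integral_indic //; last exact: measurable_paths.
  have PE := etrans (sched_prob_paths mC) (sched_probP R S h).
  by rewrite [X in (_ * X)%E]PE EFinM muleC.
rewrite sumEFin; congr EFin; elim: n F {F0} => [|n IH] F.
  by rewrite big_seq1 /path_weight big_ord0 rmorph1 mul1r.
rewrite big_words_recr iterSr -IH; apply: eq_bigr => h _; rewrite mulr_sumr.
by apply: eq_bigr => s _; rewrite path_weight_rcons rmorphM mulrA.
Qed.

Definition hit : set (path_space (init W)) :=
  [set pi | exists n, pi n == inl [set sink W]%SET].

Lemma measurable_hit : measurable hit.
Proof.
rewrite (_ : hit = \bigcup_n [set pi : path_space (init W) |
    last (init W) (mkseq pi n.+1) == inl [set sink W]%SET]).
  by apply: bigcupT_measurable => n; exact: (measurable_prefix (fun h => last _ h == _)).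
have e n pi : last (init W) (mkseq pi n.+1) = pi n.
  by rewrite /mkseq -addn1 iotaD map_cat last_cat.
apply/seteqP; split=> pi [n] => [pin|_]; first by exists n => //; rewrite /mkset e.
by rewrite /mkset e; exists n.
Qed.

Lemma first_hit_prefix (g : timestamps W -> R) n pi : paths S pi ->
  first_hit g (prefix_of pi n) =
  if `[< pi n = inl [set sink W]%SET /\ forall m, (m < n)%N -> pi m <> inl [set sink W]%SET >]
  then g (mu (transitions (prefix_of pi n))) else 0.
Proof.
move=> [pi0 _]; rewrite /first_hit; congr (if _ then _ else _).
have e : rcons (belast (init W) (prefix_of pi n)) (last (init W) (prefix_of pi n)) =
    rcons (mkseq pi n) (pi n).
  rewrite -lastI -{1}pi0 -mkseq_prefix_of /mkseq -addn1 iotaD map_cat.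
  by rewrite cats1.
have [-> ->] := rcons_inj e; apply/andP/asboolP => -[].
  move=> /mapP no /eqP ->; split=> // m mn pim; apply: no.
  by exists m; rewrite ?mem_iota.
move=> -> no; split=> //; apply/mapP => -[m]; rewrite mem_iota add0n => mn e'.
exact: (no m mn).
Qed.

Lemma nneseries_first_hit (g : timestamps W -> R) pi m : (forall x, 0 <= g x) ->
  paths S pi -> pi m = inl [set sink W]%SET ->
  (forall k, (k < m)%N -> pi k <> inl [set sink W]%SET) ->
  (\sum_(0 <= n <oo) (first_hit g (prefix_of pi n))%:E)%E =
  (g (mu (transitions (prefix_of pi m))))%:E.
Proof.
move=> g0 Dpi pim no; rewrite (nneseriesD1 (n := m)) //; last first.
  by move=> k _; rewrite lee_fin /first_hit; case: ifP.
rewrite first_hit_prefix // asboolT // eseries0 ?adde0 // => k _ /= km.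
rewrite first_hit_prefix // asboolF // => -[pik nok].
by move: km; rewrite neq_ltn => /orP[/no/(_ pik)|/nok/(_ pim)].
Qed.

Lemma finite_path_prefix pi n : paths S pi -> finite_path (prefix_of pi n).
Proof.
move=> [_ pos]; elim: n => // n IH.
by rewrite prefix_ofS; exact: finite_path_rcons (pos n).
Qed.

(** The sink carries a token, so its timestamp is not bottom and [odflt] in [top] changes
    nothing. *)
Lemma time_toE pi m : paths S pi -> pi m = inl [set sink W]%SET ->
  (forall k, (k < m)%N -> pi k <> inl [set sink W]%SET) ->
  time_to R [set sink W]%SET pi = ((top (mu (transitions (prefix_of pi m))))%:R)%:E.
Proof.
move=> Dpi pim no; rewrite /time_to; case: pselect => [ex|[]]; last by exists m; rewrite pim.
case: ex_minnP => k /eqP pik kmin.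
have -> : k = m.
  apply/eqP; rewrite eqn_leq kmin ?pim //= leqNgt.
  by apply/negP => /no.
have [pi0 _] := Dpi; rewrite mkseq_prefix_of pi0 /= -/(transitions _) /time /top.
have [_] := finite_path_current (finite_path_prefix m Dpi).
have -> : last (init W) (prefix_of pi m) = pi m.
  by case: (m) => [|j]; rewrite ?pi0 // prefix_ofS last_rcons.
rewrite pim => /(_ (sink W)); rewrite inE eqxx => /(_ isT) sinkS.
have : \big[bmax/None]_(p in [set: place W]%SET) mu (transitions (prefix_of pi m)) p != None.
  by apply: (bmax_neq_None (i := sink W)) => //; rewrite inE.
rewrite (eq_bigl xpredT) => [|p]; last by rewrite inE.
by case: (bigop _ _ _).
Qed.

(* [odd]: the MDP alternates between markings and fired transitions, so the sink is
   entered only at even times. *)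
Definition hit_mean_at (g : timestamps W -> R) n : R :=
  if odd n then 0 else hit_mean g n./2 [set source W]%SET (mu0 W).

(** Sum and integral are exchanged; every term vanishes off [hit], so each integral extends to [D],
    where [integral_prefix] and [iter_history_mean] compute it. *)
Lemma integral_first_hit g : (forall x, 0 <= g x) ->
  (\int[P]_(pi in D `&` hit) \sum_(0 <= n <oo) (first_hit g (prefix_of pi n))%:E =
   \sum_(0 <= n <oo) (hit_mean_at g n)%:E)%E.
Proof.
move=> g0.
have f0 h : 0 <= first_hit g h by rewrite /first_hit; case: ifP.
have mD := measurable_paths; have mH := measurable_hit.
rewrite integral_nneseries; last 3 first.
- exact: measurableI.
- by move=> n; apply: measurable_funS (measurable_fun_prefix _ n).
- by move=> n pi _; rewrite lee_fin.
apply: eq_eseriesr => n _.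
rewrite -[RHS](_ : (iter n (history_mean S) (first_hit g) [::])%:E = _); last first.
  by rewrite (@iter_history_mean W R S g n [::] [set source W]%SET).
rewrite -(integral_prefix _ f0) -[in RHS](setUIDK D hit) ge0_integral_setU.
- rewrite [X in (_ + X)%E]integral0_eq ?adde0 // => pi [Dpi nhit].
  rewrite first_hit_prefix // asboolF // => -[pin _].
  by apply: nhit; exists n; rewrite pin.
- exact: measurableI.
- exact: measurableD.
- by rewrite setUIDK; exact: measurable_fun_prefix.
- by move=> pi _; rewrite lee_fin.
- by apply/disj_setPS => pi [[_ ?] []].
Qed.

Lemma first_hit_time pi : hit pi -> exists2 m,
  pi m = inl [set sink W]%SET & forall k, (k < m)%N -> pi k <> inl [set sink W]%SET.
Proof.
move=> ex; have [m /eqP pim mmin] := ex_minnP ex; exists m => // k km pik.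
by have := mmin k; rewrite pik eqxx leqNgt km => /(_ isT).
Qed.

Lemma sched_prob_hit :
  P (D `&` hit) = (\sum_(0 <= n <oo) (hit_mean_at (fun=> 1) n)%:E)%E.
Proof.
have mDH : measurable (D `&` hit) := measurableI _ _ measurable_paths measurable_hit.
rewrite -integral_first_hit //.
transitivity (\int[P]_(pi in D `&` hit) cst 1%E pi)%E.
  by rewrite integral_cst // mul1e.
apply: eq_integral => pi; rewrite inE => -[Dpi Hpi].
have [m pim no] := first_hit_time Hpi.
by rewrite (nneseries_first_hit _ Dpi pim no).
Qed.

(** Off [hit] the time is infinite, which gives the second term, with [+oo * 0 = 0]. The right-hand
    side does not mention [S]: this is the independence of the scheduler. *)
Lemma expected_timeE : expected_time R S =
  (\sum_(0 <= n <oo) (hit_mean_at (fun x => (top x)%:R) n)%:E +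
   +oo * (1 - \sum_(0 <= n <oo) (hit_mean_at (fun=> 1) n)%:E))%E.
Proof.
have mD := measurable_paths; have mH := measurable_hit.
have mDH : measurable (D `&` hit) by exact: measurableI.
have mDN : measurable (D `\` hit) by exact: measurableD.
have onH pi : (D `&` hit) pi -> time_to R [set sink W]%SET pi =
    (\sum_(0 <= n <oo) (first_hit (fun x => (top x)%:R) (prefix_of pi n))%:E)%E.
  move=> [Dpi Hpi]; have [m pim no] := first_hit_time Hpi.
  by rewrite (nneseries_first_hit _ Dpi pim no) // (time_toE Dpi pim no).
have onN pi : (D `\` hit) pi -> time_to R [set sink W]%SET pi = +oo%E.
  by move=> [_ nH]; rewrite /time_to; case: pselect.
have f0 h : 0 <= first_hit (fun x => (top x)%:R) h :> R.
  by rewrite /first_hit; case: ifP.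
rewrite /expected_time -/D -(setUIDK D hit) ge0_integral_setU //; first last.
- by apply/disj_setPS => pi [[_ ?] []].
- move=> pi [/onH->|/onN->]; last exact: leey.
  by apply: nneseries_ge0 => n _ _; rewrite lee_fin.
- apply/measurable_funU => //; split.
    apply: (eq_measurable_fun (fun pi =>
      (\sum_(0 <= n <oo) (first_hit (fun x => (top x)%:R) (prefix_of pi n))%:E)%E)).
      by move=> pi; rewrite inE => /onH.
    apply: ge0_emeasurable_sum => [n pi _ _|n _]; first by rewrite lee_fin.
    by apply: measurable_funS (measurable_fun_prefix _ n).
  apply: (eq_measurable_fun (cst +oo%E)); last exact: measurable_cst.
  by move=> pi; rewrite inE => /onN.
congr (_ + _)%E.
  rewrite -integral_first_hit //.
  by apply: eq_integral => pi; rewrite inE => /onH.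
rewrite (eq_integral (cst +oo%E)) => [|pi]; last by rewrite inE => /onN.
rewrite integral_cst //; congr (_ * _)%E; rewrite -sched_prob_hit.
have PD : P D = 1%E.
  by rewrite -(setTI D) sched_prob_paths //; exact: probability_setT.
have e : (P (D `\` hit) + P (D `&` hit) = 1)%E.
  exact: etrans (esym (measureDI P mD mH)) PD.
suff : P (D `\` hit) = (1 - P (D `&` hit))%E by [].
by rewrite -e addeK // fin_num_measure.
Qed.

End PathMeasure.

(** * Bounds on the series and the theorem *)

Section Conclusion.
Variables (W : tpwn) (R : realType).

Lemma sum_hit_mean_at (g : timestamps W -> R) n : \sum_(k < n.*2) hit_mean_at g k =
  \sum_(k < n) hit_mean g k [set source W]%SET (mu0 W).
Proof.
elim: n => [|n IH]; first by rewrite !big_ord0.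
rewrite doubleS !big_ord_recr /= IH /hit_mean_at /= odd_double /= addr0.
by rewrite doubleK.
Qed.

Lemma hit_mean_at_ge0 (g : timestamps W -> R) n : (forall x, 0 <= g x) ->
  0 <= hit_mean_at g n.
Proof. by move=> g0; rewrite /hit_mean_at; case: ifP => // _; exact: hit_mean_ge0. Qed.

Lemma nneseries_hit_le (g : timestamps W -> R) B : (forall x, 0 <= g x) ->
  (forall n, \sum_(k < n) hit_mean g k [set source W]%SET (mu0 W) <= B) ->
  (\sum_(0 <= n <oo) (hit_mean_at g n)%:E <= B%:E)%E.
Proof.
move=> g0 leB; apply: lime_le.
  by apply: is_cvg_nneseries => n _ _; rewrite lee_fin hit_mean_at_ge0.
apply: nearW => n; rewrite sumEFin lee_fin big_mkord.
apply: le_trans (leB n); rewrite -sum_hit_mean_at.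
(* Half of the terms are 0, so the first [n] terms are completed to [n + n] to obtain a sum over [n]
   firing counts. *)
rewrite -addnn big_split_ord /= lerDl; apply: sumr_ge0 => k _.
exact: hit_mean_at_ge0.
Qed.

Lemma nneseries_hit_ge (g : timestamps W -> R) n : (forall x, 0 <= g x) ->
  ((\sum_(k < n) hit_mean g k [set source W]%SET (mu0 W))%:E <=
   \sum_(0 <= n <oo) (hit_mean_at g n)%:E)%E.
Proof.
move=> g0; rewrite -sum_hit_mean_at -sumEFin -(big_mkord xpredT (fun k => (hit_mean_at g k)%:E)).
by apply: nneseries_lim_ge => k _ _; rewrite lee_fin hit_mean_at_ge0.
Qed.

End Conclusion.

Theorem theorem1 (R : realType) (W : tpwn) :
  exists ET : \bar R,
    (0 <= ET)%E /\
    (forall S : scheduler W, expected_time R S = ET) /\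
    (ET \is a fin_num <-> sound (net W)).
Proof.
have rS := sreachable_source W.
set T := (\sum_(0 <= n <oo) (hit_mean_at (W := W) (fun x => (top x)%:R : R) n)%:E)%E.
set Z := (\sum_(0 <= n <oo) (hit_mean_at (W := W) (fun=> 1 : R) n)%:E)%E.
have T0 : (0 <= T)%E by apply: nneseries_ge0 => n _ _; rewrite lee_fin hit_mean_at_ge0.
have Z1 : (Z <= 1)%E by apply: nneseries_hit_le => // n; exact: sum_hit_prob_le1.
exists (T + +oo * (1 - Z))%E; split.
  apply: adde_ge0 => //; apply: mule_ge0; first exact: leey.
  by rewrite sube_ge0 // orbT.
split=> [S|]; first exact: expected_timeE.
split=> [fin M [s Ms]|soundW].
  apply: contrapT => no; move: fin; apply/negP.
  (* By 1-safety the marking is a set of places. *)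
  have sM : M = mark [set p | M p == 1%N]%SET.
    apply/ffunP => p; rewrite ffunE inE; have rM : reachable (mark [set source W]%SET) M.
      by exists s.
    by have := @net_one_safe W _ rM p; case: (M p) => [|[|]].
  rewrite sM in Ms no.
  have [p p0 le_p] := sum_hit_prob_le R (mu0 W) rS Ms no.
  (* The lost mass [p] keeps [Z] below 1, so the term [+oo * (1 - Z)] is infinite. *)
  have Zp : (Z <= (1 - p)%:E)%E by exact: nneseries_hit_le.
  have gt0 : (0 < 1 - Z)%E.
    by rewrite sube_gt0; apply: le_lt_trans Zp _; rewrite lte_fin gtrBl.
  by rewrite gt0_mulye // addey // gt_eqF // (lt_le_trans _ T0) // ltNyr.
(* [Z] is at least [1 - live_prob n], and [live_prob n] gets arbitrarily small. *)
have -> : Z = 1%E.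
  apply/eqP; rewrite eq_le Z1 /=; apply/lee_addgt0Pr => e e0.
  have [n lt_e] := live_prob_small soundW e0.
  rewrite -leeBlDr //; apply: le_trans (nneseries_hit_ge n _) => //.
  rewrite sum_hit_prob // -EFinB lee_fin lerD2l lerN2; exact: ltW.
rewrite subee // mule0 adde0.
(* A run of [k] firings takes time at most [max_delay W * k], and [B] bounds the mean number of
   firings. *)
have [B leB] := sum_live_prob_bounded R soundW.
rewrite ge0_fin_numE //; apply: (@le_lt_trans _ _ ((max_delay W)%:R * B)%:E); last exact: ltry.
apply: nneseries_hit_le => // n.
have le_B := le_trans (sum_natr_hit_prob R soundW n (mu0 W) rS) (leB n _ (mu0 W) rS).
apply: le_trans (ler_wpM2l (ler0n R (max_delay W)) le_B).
rewrite mulr_sumr; apply: ler_sum => k _; apply: le_trans (hit_mean_top _ _ _ _) _.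
rewrite (_ : top (mu0 W) = 0%N) ?add0n ?natrM ?mulrA //.
rewrite /top odflt_bmax; apply/eqP; rewrite -leqn0; apply/bigmax_leqP => p _.
by rewrite ffunE; case: ifP.
Qed.
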